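(* Let $A\in\mathbb{R}^{m\times n}$, $b\in\mathbb{R}^m$, $m\ge n$, be normalized so that $\|A\|=\|b\|=1$, let $\kappa=\operatorname{cond}(A)$, let $x=\operatorname{argmin}_{x\in\mathbb{R}^n}\|b-Ax\|$, and run the meta-algorithm (described in the context) in floating point arithmetic with unit roundoff $u$. Let $\widehat R$ be the computed R-factor and $\widehat x_0,\widehat x_1,\widehat x_2$ the computed iterates. Assume the following. (A) Numerically full-rank: $\kappa u\ll 1$. (B) Non-pathological rounding errors: the output satisfies $\|\widehat x_2\|\gtrsim \|x\|+\kappa\left(\|x\|+\kappa\|b-Ax\|\right)u$. (C) Stable sketching: $S$ is a sketching matrix for $A$ with $d\le n^3$ rows, distortion $\eta\le 0.9$, and a forward stable multiply operation $\|\operatorname{fl}(SA)-SA\|\lesssim\|A\|u$. (D) Stability of inner solver: for every right-hand side $c$, the IterativeSolver subroutine satisfies $$\left\|\operatorname{fl}(\mathrm{IterativeSolver}(c))-(\widehat R^{-\top}A^\top A\widehat R^{-1})^{-1}c\right\|\lesssim \kappa u\cdot\|c\|.$$ Then the computed iterate $x_1$ (that is, $\widehat x_1$) is strongly forward stable, and the computed iterate $x_2$ (that is, $\widehat x_2$) is backward stable.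
   Context: Norms: $\|\cdot\|$ is the Euclidean norm of a vector or the spectral norm of a matrix, $\|\cdot\|_{\rm F}$ the Frobenius norm, $\operatorname{cond}(B)=\sigma_{\max}(B)/\sigma_{\min}(B)$. Asymptotic notation: $a\lesssim b$ (equivalently $b\gtrsim a$) means $a\le c(m,n)\,b$ for a prefactor $c(m,n)$ that is a polynomial in $m$ and $n$ only. $a\ll b$ means $a\le b/c(m,n)$ for some sufficiently large polynomial $c(m,n)$; a hypothesis $a\ll b$ means that the result holds for a sufficiently large choice of this polynomial (which may depend on the polynomial prefactors in the other hypotheses). Floating point model: each arithmetic operation $\star\in\{+,-,\times,/\}$ is computed with $\operatorname{fl}(a\star b)=(a\star b)(1+\delta)$, $|\delta|\le u$, where $u$ is the unit roundoff. The numerically computed version of a quantity $f$ is denoted $\operatorname{fl}(f)$ or $\widehat f$. Expressions are evaluated in the sensible order (e.g. $AR^{-1}z$ as $A(R^{-1}z)$), triangular solves are done by substitution, and QR factorizations by Householder QR. Sketching matrix: $S\in\mathbb{R}^{d\times m}$ is a sketching matrix for $B$ with distortion $0<\eta<1$ if $(1-\eta)\|By\|\le\|SBy\|\le(1+\eta)\|By\|$ for all vectors $y$. Meta-algorithm: (1) draw a sketching matrix $S$ for $[A\ \ b]$ (with distortion $\eta$); (2) compute the (economy) Householder QR factorization $SA=QR$; (3) set $x_0=R^{-1}(Q^\top(Sb))$; (4) for $i=0,1$: set $c_i=R^{-\top}(A^\top(b-Ax_i))$; let $\delta y_i=\mathrm{IterativeSolver}(c_i)$, where IterativeSolver is a subroutine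 for solving $(R^{-\top}A^\top AR^{-1})\,\delta y=c_i$ given the routine $z\mapsto R^{-\top}(A^\top(A(R^{-1}z)))$; set $x_{i+1}=x_i+R^{-1}\delta y_i$. The forward stable multiply operation of $S$ is understood to apply also to $Sb$: $\|\operatorname{fl}(Sb)-Sb\|\lesssim\|b\|u$. Backward stability: the backward error of $\widehat x$ is $\mathrm{BE}(\widehat x)=\min\{\|\Delta A\|_{\rm F}: \widehat x=\operatorname{argmin}_{z}\|b-(A+\Delta A)z\|\}$; $\widehat x$ is backward stable if $\mathrm{BE}(\widehat x)\le c\,\|A\|_{\rm F}u$ with $c$ a polynomial in $m$ and $n$. Strong forward stability: $\widehat x$ is strongly forward stable if for some $\varepsilon\lesssim u$ both $\|x-\widehat x\|\le 2.23\operatorname{cond}(A)\left(\|x\|+\frac{\operatorname{cond}(A)}{\|A\|}\|b-Ax\|\right)\varepsilon$ and $\|A(x-\widehat x)\|\le 2.23\left(\|A\|\|x\|+\operatorname{cond}(A)\|b-Ax\|\right)\varepsilon$. *)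

(* Defs.v *)
From mathcomp Require Import all_boot all_order all_algebra.
From mathcomp Require Import all_classical all_reals.

Set Implicit Arguments.
Unset Strict Implicit.
Unset Printing Implicit Defensive.

Import Order.TTheory GRing.Theory Num.Theory.

Local Open Scope classical_set_scope.
Local Open Scope ring_scope.

Section Norms.
Context {R : realType}.

Definition frobenius_norm m n (B : 'M[R]_(m, n)) : R :=
  Num.sqrt (\sum_i \sum_j B i j ^+ 2).

Definition euclidean_norm n (v : 'cV[R]_n) : R :=
  Num.sqrt (\sum_i v i 0 ^+ 2).

(* Square roots of the eigenvalues of B^T B.  When n <= m these are exactly
   the n singular values of B; when m < n the set may also contain a spurious
   0, which does not affect [sigma_max] ([sigma_min] is only used for
   n <= m). *)
Definition singular_values m n (B : 'M[R]_(m, n)) : set R :=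
  [set s | 0 <= s /\ eigenvalue (B^T *m B) (s ^+ 2)].

Definition sigma_max m n (B : 'M[R]_(m, n)) : R := sup (singular_values B).
Definition sigma_min m n (B : 'M[R]_(m, n)) : R := inf (singular_values B).

Definition spectral_norm m n (B : 'M[R]_(m, n)) : R := sigma_max B.

(* If sigma_min B = 0 this is 0 (totalized division) and not +oo, so a
   smallness condition on [cond B] has to be paired with 0 < sigma_min B. *)
Definition cond m n (B : 'M[R]_(m, n)) : R := sigma_max B / sigma_min B.

End Norms.

Section Asymptotics.
Context {R : realType}.

Definition prefactor (c : {poly {poly R}}) (m n : nat) : R :=
  c.[m%:R, n%:R].

Definition lesssim (c : {poly {poly R}}) (m n : nat) (a b : R) : Prop :=
  a <= prefactor c m n * b.

(* Written as c(m,n) a <= b and not as a <= b / c(m,n): in the latter form a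
   polynomial c that is zero or negative would make the relation
   unsatisfiable for positive a and b. *)
Definition much_less (c : {poly {poly R}}) (m n : nat) (a b : R) : Prop :=
  prefactor c m n * a <= b.

End Asymptotics.

Section LeastSquares.
Context {R : realType}.

(* Membership in the argmin set, which is a singleton if A has full column
   rank. *)
Definition is_argmin m n (A : 'M[R]_(m, n)) (b : 'cV[R]_m) (x : 'cV[R]_n) :
    Prop :=
  forall z : 'cV[R]_n,
    euclidean_norm (b - A *m x) <= euclidean_norm (b - A *m z).

(* The set is nonempty (it contains the norm of -A) and the minimum is
   attained, since the normal equations are a closed condition on the
   perturbation; so this infimum is the minimum. *)
Definition backward_error m n (A : 'M[R]_(m, n)) (b : 'cV[R]_m)
    (xh : 'cV[R]_n) : R :=
  inf [set frobenius_norm DA | DA in [set DA | is_argmin (A + DA) b xh]].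

Definition backward_stable (c : {poly {poly R}}) (u : R) m n
    (A : 'M[R]_(m, n)) (b : 'cV[R]_m) (xh : 'cV[R]_n) : Prop :=
  lesssim c m n (backward_error A b xh) (frobenius_norm A * u).

Definition strongly_forward_stable (c : {poly {poly R}}) (u : R) m n
    (A : 'M[R]_(m, n)) (b : 'cV[R]_m) (x xh : 'cV[R]_n) : Prop :=
  exists eps : R,
    [/\ lesssim c m n eps u,
        euclidean_norm (x - xh) <=
          (223 / 100) * cond A *
          (euclidean_norm x +
           cond A / spectral_norm A * euclidean_norm (b - A *m x)) * eps
      & euclidean_norm (A *m (x - xh)) <=
          (223 / 100) *
          (spectral_norm A * euclidean_norm x +
           cond A * euclidean_norm (b - A *m x)) * eps].

Definition sketching d m n (S : 'M[R]_(d, m)) (B : 'M[R]_(m, n)) (eta : R) :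
    Prop :=
  [/\ 0 < eta, eta < 1 &
    forall y : 'cV[R]_n,
      (1 - eta) * euclidean_norm (B *m y) <= euclidean_norm (S *m (B *m y))
      /\ euclidean_norm (S *m (B *m y)) <= (1 + eta) * euclidean_norm (B *m y)].

End LeastSquares.

(* In this section every computation is a relation between its inputs and its
   possible computed outputs, each rounding being an independent arbitrary
   relative perturbation of size at most u. *)
Section FloatingPoint.
Context {R : realType} (u : R).

(* Used for +, -, *, / and also for the square root in Householder QR. *)
Definition rounds (e y : R) : Prop :=
  exists delta : R, `|delta| <= u /\ y = e * (1 + delta).

(* Summation in any order and with any bracketing; the non-emptiness
   conditions ensure that n terms cost exactly n - 1 roundings. *)
Inductive fl_sum : seq R -> R -> Prop :=
| fl_sum_nil : fl_sum [::] 0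
| fl_sum_one x : fl_sum [:: x] x
| fl_sum_add s s1 s2 y1 y2 y of
    s1 != [::] & s2 != [::] & perm_eq s (s1 ++ s2) &
    fl_sum s1 y1 & fl_sum s2 y2 & rounds (y1 + y2) y : fl_sum s y.

Definition fl_dot k (a b : 'I_k -> R) (y : R) : Prop :=
  exists p : 'I_k -> R,
    (forall i, rounds (a i * b i) (p i)) /\ fl_sum [seq p i | i <- enum 'I_k] y.

Definition fl_mulmx m k n (A : 'M[R]_(m, k)) (B : 'M[R]_(k, n))
    (C : 'M[R]_(m, n)) : Prop :=
  forall i j, fl_dot (A i) (B^~ j) (C i j).

Definition fl_addmx m n (A B C : 'M[R]_(m, n)) : Prop :=
  forall i j, rounds (A i j + B i j) (C i j).

Definition fl_submx m n (A B C : 'M[R]_(m, n)) : Prop :=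
  forall i j, rounds (A i j - B i j) (C i j).

(* Substitution for T x = z:
     x_i = (z_i - sum_(j | dep i j) T_ij x_j) / T_ii,
   where x_i is computed from those x_j with dep i j. *)
Definition fl_subst (dep : rel nat) n (T : 'M[R]_n) (z x : 'cV[R]_n) : Prop :=
  forall i : 'I_n, exists (p : 'I_n -> R) (t : R),
    [/\ forall j : 'I_n, dep i j -> rounds (T i j * x j 0) (p j),
        fl_sum (z i 0 :: [seq - p j | j : 'I_n <- enum 'I_n & dep i j]) t
      & rounds (t / T i i) (x i 0)].

(* Back substitution for T x = z, and forward substitution for T^T x = z, with
   T upper triangular. *)
Definition fl_solve n (T : 'M[R]_n) : 'cV[R]_n -> 'cV[R]_n -> Prop :=
  fl_subst ltn T.
Definition fl_solveT n (T : 'M[R]_n) : 'cV[R]_n -> 'cV[R]_n -> Prop :=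
  fl_subst (fun i j => (j < i)%N) T^T.

(* The reflector I - beta v v^T maps x to - s e_0, where
     s = sign(x_0) |x|,  v = x + s e_0,  beta = 1 / (s v_0)
   (Higham, Accuracy and Stability of Numerical Algorithms, Section 19.1).
   For x = 0, totalized division gives beta = 0, i.e. the identity. *)
Definition fl_reflector d (x : 'cV[R]_d.+1) (s : R) (v : 'cV[R]_d.+1)
    (beta : R) : Prop :=
  exists q r w : R,
    [/\ fl_dot (x^~ 0) (x^~ 0) q,
        rounds (Num.sqrt q) r,
        s = (if x 0 0 < 0 then - r else r),
        rounds (x 0 0 + s) (v 0 0)
        /\ (forall i, i != 0 -> v i 0 = x i 0)
      & rounds (s * v 0 0) w /\ rounds (1 / w) beta].

(* C = B - v (beta (v^T B)), column by column. *)
Definition fl_reflect d n (v : 'cV[R]_d) (beta : R) (B C : 'M[R]_(d, n)) :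
    Prop :=
  forall j, exists t t' : R,
    [/\ fl_dot (v^~ 0) (B^~ j) t,
        rounds (beta * t) t'
      & forall i, exists p : R,
          rounds (t' * v i 0) p /\ rounds (B i j - p) (C i j)].

(* Economy Householder QR of A (d x n): the computed Q (d x n) and R (n x n).
   The first reflector H_1 is applied to the trailing columns of A, the
   algorithm recurses on the trailing (d-1) x (n-1) block, giving Q' and R',
   and the economy Q-factor is accumulated as H_1 diag(1, Q').
   The factorization does not exist for d < n. *)
Fixpoint fl_qr d n {struct n} :
    'M[R]_(d, n) -> 'M[R]_(d, n) -> 'M[R]_n -> Prop :=
  match n, d with
  | 0, _ => fun _ _ _ => True
  | _.+1, 0 => fun _ _ _ => False
  | n'.+1, d'.+1 => fun (A Q : 'M[R]_(1 + d', 1 + n')) (T : 'M[R]_(1 + n')) =>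
      exists (s beta : R) (v : 'cV[R]_d'.+1) (B : 'M[R]_(1 + d', n'))
             (Q' : 'M[R]_(d', n')) (T' : 'M[R]_n'),
        [/\ fl_reflector (lsubmx A) s v beta,
            fl_reflect v beta (rsubmx A) B,
            fl_qr (dsubmx B) Q' T',
            T = block_mx (- s)%:M (usubmx B) 0 T'
          & fl_reflect v beta (block_mx 1%:M 0 0 Q' : 'M_(1 + d', 1 + n')) Q]
  end.

Section MetaAlgorithm.
Variables (m n : nat) (A : 'M[R]_(m, n)) (b : 'cV[R]_m).

Definition fl_operator (T : 'M[R]_n) (z y : 'cV[R]_n) : Prop :=
  exists (z1 : 'cV[R]_n) (z2 : 'cV[R]_m) (z3 : 'cV[R]_n),
    [/\ fl_solve T z z1, fl_mulmx A z1 z2, fl_mulmx A^T z2 z3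
      & fl_solveT T z3 y].

(* [solver op c dy]: dy is a possible computed output of the inner solver on
   the right-hand side c, when it is given the computed routine op. *)
Definition inner_solver : Type :=
  ('cV[R]_n -> 'cV[R]_n -> Prop) -> 'cV[R]_n -> 'cV[R]_n -> Prop.

Definition fl_refine (solver : inner_solver) (T : 'M[R]_n)
    (x x' : 'cV[R]_n) : Prop :=
  exists (y r : 'cV[R]_m) (g c dy w : 'cV[R]_n),
    [/\ fl_mulmx A x y /\ fl_submx b y r,
        fl_mulmx A^T r g /\ fl_solveT T g c,
        solver (fl_operator T) c dy,
        fl_solve T dy w
      & fl_addmx x w x'].

(* The multiplication by S is a black box, so its computed results SAh and
   Sbh are inputs here. *)
Definition meta_algorithm d (S : 'M[R]_(d, m)) (eta : R)
    (SAh : 'M[R]_(d, n)) (Sbh : 'cV[R]_d) (solver : inner_solver)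
    (Rh : 'M[R]_n) (x0 x1 x2 : 'cV[R]_n) : Prop :=
  sketching S (row_mx A b) eta /\
  exists (Qh : 'M[R]_(d, n)) (z : 'cV[R]_n),
    [/\ fl_qr SAh Qh Rh,
        fl_mulmx Qh^T Sbh z,
        fl_solve Rh z x0,
        fl_refine solver Rh x0 x1
      & fl_refine solver Rh x1 x2].

End MetaAlgorithm.
End FloatingPoint.

(* Main.v *)
Require Import Defs.
From mathcomp Require Import all_boot all_order all_algebra.
From mathcomp Require Import all_classical all_reals.
From mathcomp Require Import ring lra zify.

(** Write [e = x - xh] for the error of an iterate [xh], [rho] for the norm of
    the optimal residual [b - A x] and [kappa] for the condition number.
    Every rounding error is bounded normwise, relatively to the data of the
    operation, by [U = P u], where [P] is a polynomial in the dimensions, and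
    [kappa U] is small.

    The computed sketch is nearly [S A], Householder QR is backward stable
    ([fl_qr_err]) and the sketch distorts lengths by bounded factors only.
    Hence [|T v|] and [|A v|] agree up to absolute constants, [T] being the
    computed triangular factor ([sketched_qr]). So [A T^-1] is well
    conditioned, and the natural measure of an error is [|A e|]: it bounds
    [|e|] with a loss of one factor [kappa].

    Forward stability. The initial iterate has [|A e|] of order
    [rho + U |x|] ([sketch_and_solve_error]). A refinement step replaces
    [|A e|] by a quantity of order [U |x| + kappa U rho + kappa U |A e|]
    ([refine_contraction]). After one step the last term is dominated by the
    others, which is strong forward stability.

    Backward stability. If some vector [h] is such that [|A h|] is at most
    [eps |xh|] and the image under [A^T] of the corrected residual
    [b - A xh - A h] is at most [eps |b - A xh|], then an explicit matrix of
    rank at most two and norm of order [eps] perturbs [A] into a matrix whose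
    normal equations [xh] solves ([backward_error_bound]). The rounding errors
    of the second step have exactly this structure ([refine_error_split]).
    Those made in the large residual enter the normal equations directly, with
    size [U rho], and are left in the corrected residual. The others make up
    [h]: their image under [A] is of order [U |x|] plus terms quadratic in
    [U], of the form [kappa U^2 (|x| + kappa rho)]. The lower bound on the
    norm of the computed solution says that both are at most [U |x2|] up to a
    prefactor ([refine_backward_error]).

    All vectors and matrices are measured in the Frobenius norm, which is the
    Euclidean norm for columns; the hypotheses on [A] and on the sketch are
    brought to this form by [spectral_norm_bound] and [sigma_min_bound]. The
    given prefactors may be negative or decrease; the bound [t <= 1 + t^2]
    replaces them by a polynomial that is at least 1 and dominates them all. *)

Import Order.TTheory GRing.Theory Num.Theory.
Local Open Scope ring_scope.

Set Implicit Arguments.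
Unset Strict Implicit.
Unset Printing Implicit Defensive.

Local Notation nF := frobenius_norm.

(** * The Frobenius norm *)

Section Frobenius.
Context {R : realType}.

(** The entrywise inner product, in the form in which a factor is moved to its
    transpose on the other side by associativity alone. *)
Definition dotF m n (B C : 'M[R]_(m, n)) : R := \tr (B^T *m C).

Lemma dotFE m n (B C : 'M[R]_(m, n)) :
  dotF B C = \sum_i \sum_j B i j * C i j.
Proof.
rewrite /dotF /mxtrace exchange_big; apply: eq_bigr => j _.
by rewrite mxE; apply: eq_bigr => i _; rewrite mxE.
Qed.

Lemma dotFC m n (B C : 'M[R]_(m, n)) : dotF B C = dotF C B.
Proof. by rewrite !dotFE; do 2![apply: eq_bigr => ? _]; rewrite mulrC. Qed.

Lemma dotFDr m n (B C D : 'M[R]_(m, n)) : dotF B (C + D) = dotF B C + dotF B D.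
Proof. by rewrite /dotF mulmxDr linearD. Qed.

Lemma dotFZr m n a (B C : 'M[R]_(m, n)) : dotF B (a *: C) = a * dotF B C.
Proof. by rewrite /dotF -scalemxAr linearZ. Qed.

Lemma dotFNr m n (B C : 'M[R]_(m, n)) : dotF B (- C) = - dotF B C.
Proof. by rewrite -scaleN1r dotFZr mulN1r. Qed.

Lemma dotFBr m n (B C D : 'M[R]_(m, n)) : dotF B (C - D) = dotF B C - dotF B D.
Proof. by rewrite dotFDr dotFNr. Qed.

Lemma dotFDl m n (B C D : 'M[R]_(m, n)) : dotF (C + D) B = dotF C B + dotF D B.
Proof. by rewrite dotFC dotFDr !(dotFC B). Qed.

Lemma dotFZl m n a (B C : 'M[R]_(m, n)) : dotF (a *: B) C = a * dotF B C.
Proof. by rewrite dotFC dotFZr dotFC. Qed.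

Lemma dotFNl m n (B C : 'M[R]_(m, n)) : dotF (- B) C = - dotF B C.
Proof. by rewrite dotFC dotFNr dotFC. Qed.

Lemma dotFBl m n (B C D : 'M[R]_(m, n)) : dotF (C - D) B = dotF C B - dotF D B.
Proof. by rewrite dotFDl dotFNl. Qed.

Lemma dotF0r m n (B : 'M[R]_(m, n)) : dotF B 0 = 0.
Proof. by rewrite /dotF mulmx0 linear0. Qed.

Lemma dotF_mull p m n (M : 'M[R]_(p, m)) (B : 'M[R]_(m, n)) C :
  dotF (M *m B) C = dotF B (M^T *m C).
Proof. by rewrite /dotF trmx_mul mulmxA. Qed.

Lemma dotF_mulr p m n (M : 'M[R]_(p, m)) (B : 'M[R]_(m, n)) C :
  dotF C (M *m B) = dotF (M^T *m C) B.
Proof. by rewrite dotFC dotF_mull dotFC. Qed.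

Lemma sqr_normF m n (B : 'M[R]_(m, n)) : nF B ^+ 2 = dotF B B.
Proof.
rewrite /frobenius_norm sqr_sqrtr ?dotFE//.
by apply: sumr_ge0 => i _; apply: sumr_ge0 => j _; exact: sqr_ge0.
Qed.

Lemma normF_ge0 m n (B : 'M[R]_(m, n)) : 0 <= nF B.
Proof. exact: sqrtr_ge0. Qed.
#[local] Hint Resolve normF_ge0 : core.

Lemma normFE m n (B : 'M[R]_(m, n)) : nF B = Num.sqrt (dotF B B).
Proof. by rewrite -sqr_normF sqrtr_sqr ger0_norm. Qed.

Lemma normF0_eq0 m n (B : 'M[R]_(m, n)) : nF B = 0 -> B = 0.
Proof.
move=> B0; apply/matrixP => i j; rewrite mxE; apply/eqP; rewrite -sqrf_eq0.
have := sqr_normF B; rewrite B0 expr0n /= dotFE => /esym/eqP.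
rewrite psumr_eq0 => [/allP/(_ i)|k _]; last first.
  by apply: sumr_ge0 => l _; exact: sqr_ge0.
rewrite mem_index_enum => /(_ isT) /implyP /(_ isT).
rewrite psumr_eq0 => [/allP/(_ j)|k _]; last exact: sqr_ge0.
by rewrite mem_index_enum => /(_ isT).
Qed.

Lemma normF_gt0 m n (B : 'M[R]_(m, n)) : B != 0 -> 0 < nF B.
Proof.
move=> B0; rewrite lt_neqAle normF_ge0 andbT eq_sym.
by apply: contra_neq B0 => /normF0_eq0.
Qed.

Lemma normF0 m n : nF (0 : 'M[R]_(m, n)) = 0.
Proof. by rewrite normFE dotF0r sqrtr0. Qed.

Lemma normFZ m n a (B : 'M[R]_(m, n)) : nF (a *: B) = `|a| * nF B.
Proof. by rewrite !normFE dotFZl dotFZr mulrA sqrtrM ?sqr_ge0// sqrtr_sqr. Qed.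

Lemma normFN m n (B : 'M[R]_(m, n)) : nF (- B) = nF B.
Proof. by rewrite -scaleN1r normFZ normrN1 mul1r. Qed.

Lemma normFC m n (B C : 'M[R]_(m, n)) : nF (B - C) = nF (C - B).
Proof. by rewrite -normFN opprB. Qed.

Lemma normFT m n (B : 'M[R]_(m, n)) : nF B^T = nF B.
Proof. by rewrite !normFE /dotF trmxK mxtrace_mulC. Qed.

(** Cauchy-Schwarz: the vector [|B|^2 C - (B, C) B] has a nonnegative square
    norm. *)
Lemma dotF_sqr_le m n (B C : 'M[R]_(m, n)) :
  dotF B C ^+ 2 <= dotF B B * dotF C C.
Proof.
have [->|/normF_gt0 B0] := eqVneq B 0.
  by rewrite dotFC !dotF0r mul0r expr0n.
have := sqr_ge0 (nF (nF B ^+ 2 *: C - dotF B C *: B)).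
rewrite [X in 0 <= X]sqr_normF dotFBl !dotFBr !dotFZl !dotFZr -!sqr_normF.
rewrite (dotFC C B) => H.
rewrite -(ler_pM2l (exprn_gt0 2 B0)); lra.
Qed.

Lemma dotF_le m n (B C : 'M[R]_(m, n)) : `|dotF B C| <= nF B * nF C.
Proof.
rewrite -(@ler_pXn2r _ 2) ?nnegrE ?mulr_ge0// real_normK ?num_real//.
by rewrite exprMn !sqr_normF dotF_sqr_le.
Qed.

Lemma dotF_le_norm m n (B C : 'M[R]_(m, n)) : dotF B C <= nF B * nF C.
Proof. exact: le_trans (ler_norm _) (dotF_le _ _). Qed.

Lemma normFD m n (B C : 'M[R]_(m, n)) : nF (B + C) <= nF B + nF C.
Proof.
rewrite -(@ler_pXn2r _ 2) ?nnegrE ?addr_ge0// sqr_normF dotFDl !dotFDr.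
rewrite -!sqr_normF (dotFC C B); have := dotF_le_norm B C.
by move=> ?; rewrite sqrrD; lra.
Qed.

Lemma normFB m n (B C : 'M[R]_(m, n)) : nF (B - C) <= nF B + nF C.
Proof. by rewrite -(normFN C) normFD. Qed.

Lemma normF_le m n p q (B : 'M[R]_(m, n)) (C : 'M[R]_(p, q)) a : 0 <= a ->
  dotF B B <= a ^+ 2 * dotF C C -> nF B <= a * nF C.
Proof.
move=> a0; rewrite -!sqr_normF -exprMn ler_pXn2r ?nnegrE ?mulr_ge0//.
Qed.

Lemma normF_le_entries m n (B C : 'M[R]_(m, n)) :
  (forall i j, `|B i j| <= `|C i j|) -> nF B <= nF C.
Proof.
move=> BC; rewrite -[leRHS]mul1r; apply: normF_le => //.
rewrite expr1n mul1r !dotFE; apply: ler_sum => i _; apply: ler_sum => j _.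
rewrite -!expr2 -(real_normK (num_real (B i j))).
by rewrite -(real_normK (num_real (C i j))) ler_pXn2r ?nnegrE.
Qed.

Definition absmx m n (B : 'M[R]_(m, n)) := map_mx Num.norm B.

Lemma normF_abs m n (B : 'M[R]_(m, n)) : nF (absmx B) = nF B.
Proof.
by apply/le_anti/andP; split; apply: normF_le_entries => i j;
  rewrite mxE normr_id.
Qed.

(** Cauchy-Schwarz for each entry of the product. *)
Lemma normFM m n p (B : 'M[R]_(m, n)) (C : 'M[R]_(n, p)) :
  nF (B *m C) <= nF B * nF C.
Proof.
rewrite -(@ler_pXn2r _ 2) ?nnegrE ?mulr_ge0// exprMn !sqr_normF.
rewrite !dotFE big_distrl /=; apply: ler_sum => i _.
have -> : \sum_i0 \sum_j C i0 j * C i0 j = \sum_j \sum_k C k j * C k j.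
  exact: exchange_big.
rewrite big_distrr /=; apply: ler_sum => j _.
rewrite -expr2; have sum1 (F : 'I_n -> 'I_1 -> R) :
    \sum_k \sum_l F k l = \sum_k F k 0.
  by apply: eq_bigr => k _; rewrite big_ord1.
have := dotF_sqr_le (row i B)^T (col j C); rewrite !dotFE !sum1 => H.
rewrite mxE; suff -> : \sum_k B i k * C k j =
    \sum_k (row i B)^T k 0 * col j C k 0.
  by apply: le_trans H _; rewrite le_eqVlt; apply/orP; left; apply/eqP;
    congr (_ * _); apply: eq_bigr => k _; rewrite !mxE.
by apply: eq_bigr => k _; rewrite !mxE.
Qed.

Lemma normF_orth d m n (Q : 'M[R]_(d, m)) (B : 'M[R]_(m, n)) :
  Q^T *m Q = 1%:M -> nF (Q *m B) = nF B.
Proof. by move=> QQ; rewrite !normFE dotF_mull mulmxA QQ mul1mx. Qed.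

Lemma normF_orthT d m n (Q : 'M[R]_(d, m)) (B : 'M[R]_(d, n)) :
  Q^T *m Q = 1%:M -> nF (Q^T *m B) <= nF B.
Proof.
move=> QQ; have [->|/normF_gt0 B0] := eqVneq (Q^T *m B) 0;
  first by rewrite normF0.
rewrite -(ler_pM2l B0) -expr2 sqr_normF -dotF_mulr.
by rewrite mulrC; apply: le_trans (dotF_le_norm _ _) _; rewrite normF_orth.
Qed.

Lemma euclideanE n (v : 'cV[R]_n) : euclidean_norm v = nF v.
Proof.
by rewrite /euclidean_norm /frobenius_norm; congr Num.sqrt;
  apply: eq_bigr => i _; rewrite big_ord1.
Qed.

Lemma col_dot n (a c : 'cV[R]_n) : a^T *m c = (dotF a c)%:M.
Proof. by apply/matrixP => i j;
  rewrite !ord1 [RHS]mxE mulr1n /dotF /mxtrace big_ord1. Qed.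

Lemma dotF_row m n1 n2 (B1 C1 : 'M[R]_(m, n1)) (B2 C2 : 'M[R]_(m, n2)) :
  dotF (row_mx B1 B2) (row_mx C1 C2) = dotF B1 C1 + dotF B2 C2.
Proof. by rewrite /dotF tr_row_mx mul_col_row mxtrace_block. Qed.

Lemma dotF_col m1 m2 n (B1 C1 : 'M[R]_(m1, n)) (B2 C2 : 'M[R]_(m2, n)) :
  dotF (col_mx B1 B2) (col_mx C1 C2) = dotF B1 C1 + dotF B2 C2.
Proof. by rewrite /dotF tr_col_mx mul_row_col linearD. Qed.

Lemma dotF_cols m n (B C : 'M[R]_(m, n)) :
  dotF B C = \sum_j dotF (col j B) (col j C).
Proof.
rewrite dotFE exchange_big; apply: eq_bigr => j _; rewrite dotFE.
by apply: eq_bigr => i _; rewrite big_ord1 !mxE.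
Qed.

(** A columnwise bound sums to a bound in the Frobenius norm. *)
Lemma normF_le_cols m p n (B : 'M[R]_(m, n)) (C : 'M[R]_(p, n)) a : 0 <= a ->
  (forall j, nF (col j B) <= a * nF (col j C)) -> nF B <= a * nF C.
Proof.
move=> a0 BC; apply: normF_le => //; rewrite !dotF_cols big_distrr /=.
apply: ler_sum => j _; rewrite -!sqr_normF -exprMn.
by rewrite ler_pXn2r ?nnegrE ?mulr_ge0.
Qed.

Lemma normF1 n : nF (1%:M : 'M[R]_n) <= n%:R.
Proof.
rewrite -(@ler_pXn2r _ 2) ?nnegrE ?ler0n// sqr_normF /dotF trmx1 mul1mx
  mxtrace1.
by rewrite -natrX ler_nat; case: n => // n; rewrite leq_pmulr.
Qed.

(** The Frobenius norm exceeds the operator norm by a factor of at most the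
    square root of the number of columns. *)
Lemma normF_le_op m n (B : 'M[R]_(m, n)) a : 0 <= a ->
  (forall v : 'cV_n, nF (B *m v) <= a * nF v) -> nF B <= a * n%:R.
Proof.
move=> a0 Ba; apply: le_trans (_ : a * nF (1%:M : 'M[R]_n) <= _).
  by apply: normF_le_cols => // j; rewrite !colE mul1mx.
by rewrite ler_wpM2l// normF1.
Qed.

(** A matrix and its transpose have the same operator norm. *)
Lemma normF_opT m n (B : 'M[R]_(m, n)) a : 0 <= a ->
  (forall v : 'cV_n, nF (B *m v) <= a * nF v) ->
  forall w : 'cV_m, nF (B^T *m w) <= a * nF w.
Proof.
move=> a0 Ba w; have [->|/normF_gt0 B0] := eqVneq (B^T *m w) 0.
  by rewrite normF0 mulr_ge0.
rewrite -(ler_pM2l B0) -expr2 sqr_normF -dotF_mulr.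
apply: le_trans (dotF_le_norm _ _) _.
by have := ler_wpM2l (normF_ge0 w) (Ba (B^T *m w)); lra.
Qed.

End Frobenius.
#[export] Hint Extern 0 (is_true (0 <= frobenius_norm _)) =>
  exact: normF_ge0 : core.

(** * Extreme singular values *)

Section Spectral.
Context {R : realType}.

(** Nonnegativity of the form at [v - t N^-1 v] reads
    [q(v) >= 2 t |v|^2 - t^2 (v, N^-1 v)], and [(v, N^-1 v)] is at most
    [|N^-1| |v|^2]; so a small enough [t] gives the gap. *)
Lemma psd_unit_gap n (N : 'M[R]_n) : N^T = N ->
  (forall v : 'cV_n, 0 <= dotF v (N *m v)) -> N \in unitmx ->
  exists2 c, 0 < c & forall v : 'cV_n, c * dotF v v <= dotF v (N *m v).
Proof.
move=> NT N0 Nu; have C0 : 0 < nF (invmx N) + 1 by rewrite ltr_wpDl ?normF_ge0.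
set C := nF (invmx N) + 1 in C0; exists C^-1; first by rewrite invr_gt0.
move=> v; set w := invmx N *m v.
have Nw : N *m w = v by rewrite mulmxA mulmxV// mul1mx.
have wv : dotF w v <= C * dotF v v.
  rewrite -sqr_normF; apply: le_trans (dotF_le_norm _ _) _.
  have := normFM (invmx N) v; rewrite -/w => H.
  have := ler_wpM2r (normF_ge0 v) H; have := sqr_ge0 (nF v).
  rewrite /C; lra.
have := N0 (v - C^-1 *: w).
rewrite mulmxBr -scalemxAr Nw dotFBl !dotFBr !dotFZl !dotFZr (dotF_mulr N v w).
rewrite NT Nw => H.
have : C^-1 * (C^-1 * dotF w v) <= C^-1 * dotF v v.
  by rewrite ler_pM2l ?invr_gt0// ler_pdivrMl.
lra.
Qed.

Lemma eigenvalue_singular n (G : 'M[R]_n) a :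
  G - a%:M \notin unitmx -> eigenvalue G a.
Proof. by rewrite /eigenvalue /eigenspace kermx_eq0 row_free_unit. Qed.

(** If the infimum [a] of the Rayleigh quotient were not an eigenvalue, then
    [G - a] would be an invertible semidefinite matrix, hence bounded below by
    a positive constant, and [a] would not be the greatest lower bound. No
    diagonalization is involved. *)
Lemma rayleigh_inf n (G : 'M[R]_n) (v0 : 'cV[R]_n) : G^T = G -> v0 != 0 ->
  exists2 a, eigenvalue G a &
    forall v : 'cV_n, a * dotF v v <= dotF v (G *m v).
Proof.
move=> GT v00; pose E := [set dotF v (G *m v) | v in [set v :
  'cV_n | nF v = 1]]%classic.
have nE : (E !=set0)%classic.
  exists (dotF ((nF v0)^-1 *: v0) (G *m ((nF v0)^-1 *: v0))).
  exists ((nF v0)^-1 *: v0) => //=; rewrite normFZ ger0_norm ?invr_ge0//.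
  by rewrite mulVf// gt_eqF// normF_gt0.
have lE : has_lbound E.
  exists (- nF G) => _ [v /= v1 <-]; rewrite lerNl -dotFNr.
  apply: le_trans (dotF_le_norm _ _) _; rewrite normFN v1 mul1r.
  by apply: le_trans (normFM _ _) _; rewrite v1 mulr1.
have aE (v : 'cV_n) : inf E * dotF v v <= dotF v (G *m v).
  have [->|/normF_gt0 vp] := eqVneq v 0; first by rewrite mulmx0 dotF0r mulr0.
  have : inf E <= (nF v)^-1 ^+ 2 * dotF v (G *m v).
    apply: (ge_inf lE); exists ((nF v)^-1 *: v) => /=.
      by rewrite normFZ ger0_norm ?invr_ge0// mulVf// gt_eqF.
    by rewrite -scalemxAr dotFZl dotFZr mulrA.
  by rewrite exprVn ler_pdivlMl ?exprn_gt0// sqr_normF mulrC.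
exists (inf E) => //; apply: eigenvalue_singular; apply/negP => Nu.
have NE (v : 'cV_n) : dotF v ((G - (inf E)%:M) *m v) =
    dotF v (G *m v) - inf E * dotF v v.
  by rewrite mulmxBl mul_scalar_mx dotFBr dotFZr.
have [||c c0 cN] := psd_unit_gap _ _ Nu.
- by rewrite linearB /= GT tr_scalar_mx.
- by move=> v; rewrite NE subr_ge0.
have : inf E + c <= inf E.
  apply: lb_le_inf => // _ [v /= v1 <-]; have := cN v.
  by rewrite NE -sqr_normF v1 expr1n; lra.
by lra.
Qed.

Lemma gram_tr m n (B : 'M[R]_(m, n)) : (B^T *m B)^T = B^T *m B.
Proof. by rewrite trmx_mul trmxK. Qed.

Lemma dotF_gram m n (B : 'M[R]_(m, n)) (v : 'cV_n) :
  dotF v (B^T *m B *m v) = nF (B *m v) ^+ 2.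
Proof. by rewrite -mulmxA dotF_mulr trmxK sqr_normF. Qed.

Lemma singular_value_vector m n (B : 'M[R]_(m, n)) s : singular_values B s ->
  exists2 v : 'cV_n, 0 < nF v & nF (B *m v) = s * nF v.
Proof.
case=> s0 /eigenvalueP[w wB w0]; exists w^T; first by rewrite normFT normF_gt0.
have Bw : B^T *m B *m w^T = s ^+ 2 *: w^T.
  by rewrite -linearZ /= -wB trmx_mul gram_tr.
apply/eqP; rewrite -(@eqrXn2 _ 2) ?mulr_ge0//; apply/eqP.
by rewrite -dotF_gram Bw dotFZr exprMn sqr_normF.
Qed.

Lemma singular_value_le m n (B : 'M[R]_(m, n)) s :
  singular_values B s -> s <= nF B.
Proof.
move=> /singular_value_vector[v v0 Bv]; rewrite -(ler_pM2r v0) -Bv.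
exact: normFM.
Qed.

Lemma spectral_norm_le_normF m n (B : 'M[R]_(m, n)) : spectral_norm B <= nF B.
Proof.
rewrite /spectral_norm /sigma_max.
have [->|nE] := eqVneq (singular_values B) set0; first by rewrite sup0.
by apply: ge_sup; [exact/set0P|move=> s; exact: singular_value_le].
Qed.

(** The supremum of the Rayleigh quotient of [B^T B] is an eigenvalue, by
    [rayleigh_inf] for the opposite matrix; its square root is therefore one
    of the singular values. *)
Lemma spectral_norm_bound m n (B : 'M[R]_(m, n)) (v : 'cV_n) :
  nF (B *m v) <= spectral_norm B * nF v.
Proof.
have [->|v0] := eqVneq v 0; first by rewrite mulmx0 !normF0 mulr0.
have [|a Ga aB] := @rayleigh_inf _ (- (B^T *m B)) v _ v0.
  by rewrite linearN /= gram_tr.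
have aB' (w : 'cV_n) : nF (B *m w) ^+ 2 <= - a * dotF w w.
  by have := aB w; rewrite mulNmx dotFNr dotF_gram; lra.
have a0 : 0 <= - a.
  have := le_trans (sqr_ge0 _) (aB' v); rewrite pmulr_lge0//.
  by rewrite -sqr_normF exprn_gt0// normF_gt0.
have sB : singular_values B (Num.sqrt (- a)).
  split; first exact: sqrtr_ge0.
  rewrite sqr_sqrtr//; have /eigenvalueP[w wG w0] := Ga.
  by apply/eigenvalueP; exists w => //; rewrite scaleNr -wG mulmxN opprK.
have : Num.sqrt (- a) <= spectral_norm B.
  apply: ub_le_sup => //; exists (nF B) => s; exact: singular_value_le.
move=> /(ler_wpM2r (normF_ge0 v)) H; apply: le_trans H.
rewrite -(@ler_pXn2r _ 2) ?nnegrE ?mulr_ge0 ?sqrtr_ge0//.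
by rewrite exprMn (sqr_sqrtr a0) (sqr_normF v).
Qed.

Lemma sigma_min_bound m n (B : 'M[R]_(m, n)) (v : 'cV_n) :
  sigma_min B * nF v <= nF (B *m v).
Proof.
have [->|v0] := eqVneq v 0; first by rewrite mulmx0 !normF0 mulr0.
have [a Ga aB] := rayleigh_inf (gram_tr B) v0.
have a0 : 0 <= a.
  have /eigenvalueP[w wG w0] := Ga; have := sqr_ge0 (nF (B *m w^T)).
  rewrite -dotF_gram; have -> : B^T *m B *m w^T = a *: w^T.
    by rewrite -linearZ /= -wG trmx_mul gram_tr.
  by rewrite dotFZr pmulr_lge0// -sqr_normF exprn_gt0// normFT normF_gt0.
have : sigma_min B <= Num.sqrt a.
  apply: ge_inf; first by exists 0 => s [].
  by split; [exact: sqrtr_ge0|rewrite sqr_sqrtr].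
move=> /(ler_wpM2r (normF_ge0 v)) /le_trans; apply.
rewrite -(@ler_pXn2r _ 2) ?nnegrE ?mulr_ge0 ?sqrtr_ge0//.
by rewrite exprMn (sqr_sqrtr a0) (sqr_normF v) -dotF_gram.
Qed.

End Spectral.

(** * Rounding errors of sums, products and substitution *)

Section Rounding.
Context {R : realType} (u : R) (u0 : 0 <= u).

(** The usual constant [k u / (1 - k u)] of error analysis is replaced by
    [(1 + u)^k - 1], which composes without loss: see [gamS]. *)
Definition gam k : R := (1 + u) ^+ k - 1.

Lemma gamS k : gam k.+1 = (1 + u) * gam k + u.
Proof. by rewrite /gam exprS; ring. Qed.

Lemma gam_ge0 k : 0 <= gam k.
Proof. by rewrite /gam subr_ge0 exprn_ege1// lerDl. Qed.

Lemma ler_gam k l : (k <= l)%N -> gam k <= gam l.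
Proof. by move=> kl; rewrite lerD2r ler_weXn2l// lerDl. Qed.

Lemma gam_le N : 2 * N%:R * u <= 1 -> gam N <= 2 * N%:R * u.
Proof.
move=> Nu; suff H k : (k <= N)%N -> gam k <= 2 * k%:R * u by exact: H.
elim: k => [|k IH] kN; first by rewrite /gam expr0 subrr mulr0 mul0r.
have {}IH := IH (ltnW kN); rewrite gamS -natr1.
have kN' : k%:R <= N%:R :> R by rewrite ler_nat ltnW.
have := ler_wpM2l u0 IH.
have := ler_wpM2l u0 (le_trans (ler_wpM2r u0 (ler_wpM2l (ler0n R 2) kN')) Nu).
by nra.
Qed.

Lemma rounds_err e y : rounds u e y -> `|y - e| <= u * `|e|.
Proof.
case=> dl [dlu ->]; have -> : e * (1 + dl) - e = dl * e by ring.
by rewrite normrM ler_wpM2r.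
Qed.

(** Both summands of the outermost addition have fewer terms than the whole,
    so the depth of the summation tree, and with it the number of factors
    [1 + u] that meet any one term, is at most the number of terms whatever the
    bracketing. *)
Lemma fl_sum_err s y : fl_sum u s y ->
  `|y - \sum_(x <- s) x| <= gam (size s) * \sum_(x <- s) `|x|.
Proof.
elim=> {s y} [|x|s s1 s2 y1 y2 y s1n s2n ss _ IH1 _ IH2 /rounds_err yE].
- by rewrite !big_nil subr0 normr0 mulr0.
- by rewrite !big_seq1 subrr normr0 mulr_ge0// gam_ge0.
rewrite !(perm_big _ ss) /= !big_cat /= (perm_size ss) size_cat.
set t1 := \sum_(x <- s1) x in IH1 *; set t2 := \sum_(x <- s2) x in IH2 *.
set a1 := \sum_(x <- s1) _ in IH1 *; set a2 := \sum_(x <- s2) _ in IH2 *.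
have [k kE] : exists k, (size s1 + size s2 = k.+1)%N.
  by case: s1 s1n {ss IH1 t1 a1} => // x s1 _; exists (size s1 + size s2)%N.
have k1 : gam (size s1) <= gam k.
  by apply: ler_gam; case: s2 s2n kE {ss IH2 t2 a2} => //= x s2 _; lia.
have k2 : gam (size s2) <= gam k.
  by apply: ler_gam; case: s1 s1n kE {ss IH1 t1 a1 k1} => //= x s1 _; lia.
have a10 : 0 <= a1 by apply: sumr_ge0.
have a20 : 0 <= a2 by apply: sumr_ge0.
have ta1 : `|t1| <= a1 by exact: ler_norm_sum.
have ta2 : `|t2| <= a2 by exact: ler_norm_sum.
have tt : `|y1 + y2 - (t1 + t2)| <= gam k * (a1 + a2).
  have -> : y1 + y2 - (t1 + t2) = (y1 - t1) + (y2 - t2) by ring.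
  apply: le_trans (ler_normD _ _) _; rewrite mulrDr lerD//.
    by apply: le_trans IH1 _; rewrite ler_wpM2r.
  by apply: le_trans IH2 _; rewrite ler_wpM2r.
have t12 : `|t1 + t2| <= a1 + a2 by apply: le_trans (ler_normD _ _) (lerD _ _).
have y12 : `|y1 + y2| <= gam k * (a1 + a2) + (a1 + a2).
  have -> : y1 + y2 = (y1 + y2 - (t1 + t2)) + (t1 + t2) by ring.
  by apply: le_trans (ler_normD _ _) (lerD _ _).
have := ler_wpM2l u0 y12.
have : `|y - (t1 + t2)| <= `|y - (y1 + y2)| + `|y1 + y2 - (t1 + t2)|.
  by apply: le_trans (ler_normD _ _); rewrite le_eqVlt; apply/orP; left;
    apply/eqP; congr `|_|; ring.
by rewrite kE gamS; lra.
Qed.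

(** A sum whose terms carry one further relative error each. *)
Lemma fl_sum_rounded_err (T : Type) (r : seq T) (a p : T -> R) y :
  (forall i, `|p i - a i| <= u * `|a i|) -> fl_sum u (map p r) y ->
  `|y - \sum_(i <- r) a i| <= gam (size r).+1 * \sum_(i <- r) `|a i|.
Proof.
move=> pa /fl_sum_err; rewrite !big_map size_map => yE.
set g := gam _ in yE; have g0 : 0 <= g by exact: gam_ge0.
have pE i : `|p i| <= (1 + u) * `|a i|.
  by have := pa i; have := ler_normD (p i - a i) (a i); rewrite subrK; lra.
have S1 : `|\sum_(i <- r) p i - \sum_(i <- r) a i| <= u * \sum_(i <- r) `|a i|.
  rewrite -sumrB mulr_sumr; apply: le_trans (ler_norm_sum _ _ _) _.
  by apply: ler_sum => i _.
have S2 : \sum_(i <- r) `|p i| <= (1 + u) * \sum_(i <- r) `|a i|.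
  by rewrite mulr_sumr; apply: ler_sum => i _.
have := ler_wpM2l g0 S2; rewrite gamS -/g.
have := ler_normD (y - \sum_(i <- r) p i) (\sum_(i <- r) p i - \sum_(i <- r) a
  i).
by rewrite addrA subrK; lra.
Qed.

Lemma fl_dot_err k (a b : 'I_k -> R) y : fl_dot u a b y ->
  `|y - \sum_i a i * b i| <= gam k.+1 * \sum_i `|a i| * `|b i|.
Proof.
case=> p [pE /fl_sum_rounded_err yE].
have := yE (fun i => a i * b i) (fun i => rounds_err (pE i)).
rewrite size_enum_ord !big_enum /=.
by under [X in _ <= _ * X]eq_bigr do rewrite normrM.
Qed.

Lemma fl_dot_err_normF k (a b : 'cV[R]_k) y : fl_dot u (a^~ 0) (b^~ 0) y ->
  `|y - dotF a b| <= gam k.+1 * (nF a * nF b).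
Proof.
move=> /fl_dot_err yE; rewrite -(normF_abs a) -(normF_abs b).
have := dotF_le_norm (absmx a) (absmx b); rewrite !dotFE.
have sum1 (F : 'I_k -> 'I_1 -> R) : \sum_i \sum_j F i j = \sum_i F i 0.
  by apply: eq_bigr => i _; rewrite big_ord1.
rewrite !sum1; under eq_bigr do rewrite !mxE.
by move=> /(ler_wpM2l (gam_ge0 k.+1)); apply: le_trans.
Qed.

Lemma fl_mulmx_err m k n (A : 'M[R]_(m, k)) (B : 'M[R]_(k, n)) C :
  fl_mulmx u A B C -> nF (C - A *m B) <= gam k.+1 * (nF A * nF B).
Proof.
move=> CE; apply: le_trans (_ : gam k.+1 * nF (absmx A *m absmx B) <= _).
  rewrite -[gam _]ger0_norm ?gam_ge0// -normFZ.
  apply: normF_le_entries => i j; rewrite !mxE [leRHS]ger0_norm.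
    apply: le_trans (fl_dot_err (CE i j)) _; rewrite ler_wpM2l ?gam_ge0//.
    by apply: ler_sum => l _; rewrite !mxE.
  by rewrite mulr_ge0 ?gam_ge0// sumr_ge0// => l _; rewrite !mxE mulr_ge0.
by rewrite ler_wpM2l ?gam_ge0// -(normF_abs A) -(normF_abs B) normFM.
Qed.

Lemma fl_addmx_err m n (A B C : 'M[R]_(m, n)) :
  fl_addmx u A B C -> nF (C - (A + B)) <= u * nF (A + B).
Proof.
move=> CE; rewrite -[u]ger0_norm// -normFZ; apply: normF_le_entries => i j.
by rewrite !mxE normrM (ger0_norm u0) rounds_err.
Qed.

Lemma fl_submx_err m n (A B C : 'M[R]_(m, n)) :
  fl_submx u A B C -> nF (C - (A - B)) <= u * nF (A - B).
Proof.
by move=> CE; apply: fl_addmx_err => i j; have := CE i j; rewrite !mxE.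
Qed.

(** The computed entry [x_i] solves the [i]-th equation up to the errors of one
    sum and one division. The errors relative to [z_i] are moved to the terms
    [T_ij x_j] by bounding [z_i] with the residual itself, which is possible
    because [e] is at most 1/2. *)
Lemma fl_subst_err (dep : rel nat) n (T : 'M[R]_n) z x e :
  (forall i : 'I_n, ~~ dep i i) ->
  (forall i j : 'I_n, i != j -> ~~ dep i j -> T i j = 0) ->
  (forall i, T i i != 0) -> u <= e -> gam n.+2 <= e -> e <= 1 / 2 ->
  fl_subst u dep T z x -> nF (T *m x - z) <= 6 * e * (nF T * nF x).
Proof.
move=> dirr dT T0 ue ge e2 xE; have e0 := le_trans u0 ue.
apply: le_trans (_ : 6 * e * nF (absmx T *m absmx x) <= _); last first.
  by rewrite ler_wpM2l ?mulr_ge0// -(normF_abs T) -(normF_abs x) normFM.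
rewrite -[6 * e]ger0_norm ?mulr_ge0// -normFZ.
apply: normF_le_entries => i j; rewrite !mxE (ord1 j) [leRHS]ger0_norm;
  last first.
  by rewrite !mulr_ge0// sumr_ge0// => l _; rewrite !mxE mulr_ge0.
have [p [t [pE tE xiE]]] := xE i.
pose r := [seq j : 'I_n <- enum 'I_n | dep i j].
have sumE (F : 'I_n -> R) : (forall j, i != j -> ~~ dep i j -> F j = 0) ->
    \sum_j F j = F i + \sum_(j <- r) F j.
  move=> F0; rewrite (bigD1 i)//= big_filter big_enum_cond /=; congr (_ + _).
  rewrite big_mkcond [RHS]big_mkcond /=; apply: eq_bigr => k _.
  rewrite eq_sym; have [<-|ik] /= := eqVneq i k;
    first by rewrite (negPf (dirr i)).
  by case: ifPn => // /(F0 _ ik).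
rewrite (sumE (fun k => T i k * x k 0)); last by move=> k ik /(dT _ _ ik) ->;
  rewrite mul0r.
rewrite (sumE (fun k => absmx T i k * absmx x k 0)); last first.
  by move=> k ik /(dT _ _ ik) H; rewrite mxE H normr0 mul0r.
under [X in _ <= _ * (_ + X)]eq_bigr do rewrite !mxE -normrM.
rewrite !mxE -normrM.
set S := \sum_(k <- r) `|_|; set L := \sum_(k <- r) _; set D := T i i * x i 0.
have rn : (size r <= n)%N
  by rewrite size_filter; apply: leq_trans (count_size _ _) _;
    rewrite size_enum_ord.
have pE' (k : 'I_n) : k \in r ->
  `|- p k - - (T i k * x k 0)| <= u * `|- (T i k * x k 0)|.
  rewrite mem_filter => /andP[/pE/rounds_err kE _].
  by rewrite opprK addrC normrN distrC.
(* [fl_sum_rounded_err] wants an error bound for all indices, whereas [p] is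
   constrained at those in [r] only. *)
have [q [qE qr]] : exists q : 'I_n -> R,
    (forall k, `|q k - - (T i k * x k 0)| <= u * `|- (T i k * x k 0)|) /\
    [seq - p k | k <- r] = map q r.
  exists (fun k => if k \in r then - p k else - (T i k * x k 0)); split.
    by move=> k; case: ifPn => [/pE'//|_]; rewrite subrr normr0 mulr_ge0.
  by apply/eq_in_map => k ->.
(* The index [None] stands for the right-hand side [z i 0], which enters the
   sum exactly. *)
have {}tE : `|t - (z i 0 - L)| <= e * (`|z i 0| + S).
  have := @fl_sum_rounded_err _ (None :: map Some r)
    (fun o => if o is Some k then - (T i k * x k 0) else z i 0)
    (fun o => if o is Some k then q k else z i 0) t.
  rewrite /= -map_comp !big_cons !big_map size_map sumrN /=.
  have -> : \sum_(k <- r) `|- (T i k * x k 0)| = S.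
    by apply: eq_bigr => k _; rewrite normrN.
  move=> H; apply: le_trans (H _ _) _.
  - by case=> [k|]; [exact: qE|rewrite subrr normr0 mulr_ge0].
  - by move: tE; rewrite -/r qr.
  rewrite ler_wpM2r ?addr_ge0 ?sumr_ge0//.
  by apply: le_trans ge; apply: ler_gam.
have xtE : `|D - t| <= u * `|t|.
  have Tt : T i i * (t / T i i) = t by rewrite mulrCA mulfV// mulr1.
  have := ler_wpM2l (normr_ge0 (T i i)) (rounds_err xiE).
  by rewrite mulrCA -!normrM mulrBr Tt.
have LS : `|L| <= S by exact: ler_norm_sum.
have S0 : 0 <= S by rewrite sumr_ge0.
have zE : `|z i 0| <= `|D + L - z i 0| + `|D| + S.
  have := ler_normD (z i 0 - (D + L)) (D + L); rewrite subrK distrC.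
  by have := ler_normD D L; lra.
have DtE : `|D + L - z i 0| <= `|D - t| + `|t - (z i 0 - L)|.
  by apply: le_trans (ler_normD _ _); rewrite le_eqVlt; apply/orP; left;
    apply/eqP; congr `|_|; ring.
have tD : `|t| <= `|D| + `|D - t|.
  by have := ler_normD (t - D) D; rewrite subrK distrC; lra.
have t0 := normr_ge0 t; have D0 := normr_ge0 D; have z0 := normr_ge0 (z i 0).
have h1 : u * `|t| <= e * `|t| by rewrite ler_wpM2r.
have h2 : e * `|t| <= 1 / 2 * `|t| by rewrite ler_wpM2r.
have h3 := ler_wpM2l e0 zE; have tD2 : `|t| <= 2 * `|D| by lra.
have h4 := ler_wpM2l e0 tD2.
have h5 : e * `|D + L - z i 0| <= 1 / 2 * `|D + L - z i 0| by rewrite ler_wpM2r.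
have h6 : 0 <= e * S by rewrite mulr_ge0.
lra.
Qed.

End Rounding.

(** * Rounding errors of one Householder reflection *)

Section Householder.
Context {R : realType} (u : R) (u0 : 0 <= u).

Definition near_rel (e x y : R) := `|y - x| <= e * `|x|.

Lemma near_relW a b x y : a <= b -> near_rel a x y -> near_rel b x y.
Proof. by move=> ab H; apply: le_trans H _; rewrite ler_wpM2r. Qed.

Lemma near_relM a b c x x' y y' : 0 <= a -> a + b + a * b <= c ->
  near_rel a x x' -> near_rel b y y' -> near_rel c (x * y) (x' * y').
Proof.
move=> a0 abc xx yy; apply: near_relW abc _; rewrite /near_rel in xx yy *.
have -> : x' * y' - x * y = (x' - x) * y + (x' - x) * (y' - y) + x * (y' - y).
  by ring.
apply: le_trans (ler_normD _ _) _.
have := ler_normD ((x' - x) * y) ((x' - x) * (y' - y)); rewrite !normrM.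
have := ler_wpM2r (normr_ge0 y) xx; have := ler_wpM2l (normr_ge0 x) yy.
have := ler_pM (normr_ge0 _) (normr_ge0 _) xx yy; lra.
Qed.

Lemma near_rel_rounds a c x y z : 0 <= a -> a + u + a * u <= c ->
  near_rel a x y -> rounds u y z -> near_rel c x z.
Proof.
move=> a0 ac xy [dl [dlu ->]].
rewrite -[x]mulr1; apply: near_relM ac xy _ => //.
by rewrite /near_rel normr1 mulr1 addrAC subrr add0r.
Qed.

(** With [0^-1 = 0] this includes the case [x = 0], in which [y = 0] too. *)
Lemma near_relV (a b x y : R) : 0 <= b -> a < 1 -> a <= b * (1 - a) ->
  near_rel a x y -> near_rel b x^-1 y^-1.
Proof.
rewrite /near_rel => b0 a1 ab xy; have [x0|x0] := eqVneq x 0.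
  by move: xy; rewrite x0 normr0 mulr0 normr_le0 subr0 => /eqP ->;
    rewrite invr0 subrr normr0 mulr0.
have xp : 0 < `|x| by rewrite normr_gt0.
have yx : (1 - a) * `|x| <= `|y|.
  have := ler_normD (x - y) y; rewrite subrK distrC; lra.
have yp : 0 < `|y| by apply: lt_le_trans yx; rewrite mulr_gt0// subr_gt0.
have y0 : y != 0 by rewrite -normr_gt0.
have -> : y^-1 - x^-1 = - (y - x) / (x * y) by field; rewrite y0.
rewrite normrM normrN !normfV normrM ler_pdivrMr ?mulr_gt0//.
have -> : b * `|x|^-1 * (`|x| * `|y|) = b * `|y| by field; rewrite gt_eqF.
apply: le_trans xy _.
have := ler_wpM2l b0 yx; have := ler_wpM2r (ltW xp) ab.
lra.
Qed.

Definition reflection d (v : 'cV[R]_d) (beta : R) : 'M[R]_d :=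
  1%:M - beta *: (v *m v^T).

Lemma reflectionE d p (v : 'cV[R]_d) beta (B : 'M[R]_(d, p)) i j :
  (reflection v beta *m B) i j = B i j - beta * (v i 0 * dotF v (col j B)).
Proof.
rewrite mulmxBl mul1mx -scalemxAl -mulmxA !mxE big_ord1 dotFE;
  congr (_ - _ * (_ * _)).
by rewrite mxE; apply: eq_bigr => k _; rewrite big_ord1 !mxE.
Qed.

Lemma reflection_tr d (v : 'cV[R]_d) beta :
  (reflection v beta)^T = reflection v beta.
Proof. by rewrite linearB /= linearZ /= trmx1 trmx_mul trmxK. Qed.

Lemma reflection_orth d (v : 'cV[R]_d) beta : beta * dotF v v = 2 \/ beta = 0 ->
  (reflection v beta)^T *m reflection v beta = 1%:M.
Proof.
move=> vb; rewrite reflection_tr.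
rewrite {2}/reflection mulmxBr mulmx1 -scalemxAr {2}/reflection mulmxBl mul1mx.
rewrite -scalemxAl mulmxA -(mulmxA v) col_dot mul_mx_scalar -scalemxAl scalerA.
rewrite /reflection scalerBr scalerA opprB.
case: vb => [->|->]; last by rewrite !mul0r !scale0r subr0 subrr addr0.
by rewrite -scalerBl [beta * 2]mulrC (_ : 2 * beta - beta = beta) ?subrK//;
  ring.
Qed.

(** All the products formed for one entry of column [c] are relatively accurate
    up to errors proportional to [|v0| |c|], so the error of the column is a
    multiple of [beta0 |v0|^2 |c|], and [beta0 |v0|^2] is at most 2. *)
Lemma fl_reflect_err d n (v0 v : 'cV[R]_d) beta0 beta (B C : 'M[R]_(d, n)) e :
  u <= e -> gam u d.+1 <= e -> e <= 1 / 1000 ->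
  (forall i, near_rel (5 * e) (v0 i 0) (v i 0)) ->
  near_rel (14 * e) beta0 beta -> 0 <= beta0 -> beta0 * dotF v0 v0 <= 2 ->
  fl_reflect u v beta B C -> nF (C - reflection v0 beta0 *m B) <= 70 * e * nF B.
Proof.
move=> ue ge e3 vE bE b0 bv CE; have e0 := le_trans u0 ue.
have ee : e * e <= 1 / 1000 * e by rewrite ler_wpM2r.
have ue2 : u * e <= 1 / 1000 * e by rewrite ler_wpM2r// (le_trans ue).
apply: normF_le_cols; first by rewrite mulr_ge0.
move=> j; have [t [t' [tE t'E {}CE]]] := CE j.
set cj := col j B.
pose tau := nF v0 * nF cj.
have tau0 : 0 <= tau by rewrite mulr_ge0.
have vn : nF v <= (1 + 5 * e) * nF v0.
  rewrite -[1 + _]ger0_norm ?addr_ge0 ?mulr_ge0// -normFZ.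
  apply: normF_le_entries => i k; rewrite (ord1 k) mxE normrM.
  rewrite [`|1 + _|]ger0_norm ?addr_ge0 ?mulr_ge0//.
  by have := vE i; have := ler_normD (v i 0 - v0 i 0) (v0 i 0);
    rewrite subrK /near_rel; lra.
have vd : nF (v - v0) <= 5 * e * nF v0.
  rewrite -[5 * e]ger0_norm ?mulr_ge0// -normFZ.
  apply: normF_le_entries => i k; rewrite (ord1 k) !mxE normrM.
  by rewrite (ger0_norm (_ : 0 <= 5 * e)) ?mulr_ge0//; exact: vE.
have {}tE : `|t - dotF v0 cj| <= 7 * e * tau.
  have h1 : `|t - dotF v cj| <= e * (nF v * nF cj).
    have cjE : B^~ j = cj^~ 0 by apply/funext => i; rewrite mxE.
    rewrite cjE in tE; apply: le_trans (fl_dot_err_normF u0 tE) _.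
    by rewrite ler_wpM2r// mulr_ge0.
  have h2 : `|dotF v cj - dotF v0 cj| <= 5 * e * tau.
    rewrite -dotFBl; apply: le_trans (dotF_le _ _) _.
    by rewrite /tau mulrA ler_wpM2r.
  have h3 : nF v * nF cj <= (1 + 5 * e) * tau by rewrite /tau mulrA ler_wpM2r.
  have h4 := ler_wpM2l e0 h3; have h5 := ler_wpM2r tau0 ee.
  have := ler_normD (t - dotF v cj) (dotF v cj - dotF v0 cj).
  by rewrite addrA subrK; have := mulr_ge0 e0 tau0; lra.
have t0 : `|dotF v0 cj| <= tau by exact: dotF_le.
pose bt := beta0 * tau; have bt0 : 0 <= bt by rewrite mulr_ge0.
have et0 : 0 <= e * tau by rewrite mulr_ge0.
have eb0 : 0 <= e * bt by rewrite mulr_ge0.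
have bE' : `|beta - beta0| <= 14 * e * beta0 by rewrite -{2}(ger0_norm b0).
have {}t'E : `|t' - beta0 * dotF v0 cj| <= 24 * e * bt.
  have h1 : `|beta * t - beta0 * dotF v0 cj| <= 22 * e * bt.
    have -> : beta * t - beta0 * dotF v0 cj = (beta - beta0) * (t - dotF v0 cj)
      + (beta - beta0) * dotF v0 cj + beta0 * (t - dotF v0 cj) by ring.
    apply: le_trans (ler_normD _ _) _.
    have := ler_normD ((beta - beta0) * (t - dotF v0 cj)) ((beta - beta0) * dotF
      v0 cj).
    rewrite !normrM (ger0_norm b0).
    have := ler_pM (normr_ge0 _) (normr_ge0 _) bE' tE.
    have := ler_pM (normr_ge0 _) (normr_ge0 _) bE' t0.
    have := ler_wpM2l b0 tE; have := ler_wpM2r bt0 ee; move: eb0; rewrite /bt;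
      lra.
  have h2 : `|beta * t| <= (1 + 22 * e) * bt.
    have := ler_normD (beta * t - beta0 * dotF v0 cj) (beta0 * dotF v0 cj).
    rewrite subrK; have := ler_wpM2l b0 t0;
      rewrite [`|beta0 * _|]normrM (ger0_norm b0) -/bt.
    lra.
  have := rounds_err t'E; have := ler_wpM2l u0 h2.
  have := ler_normD (t' - beta * t) (beta * t - beta0 * dotF v0 cj).
  rewrite addrA subrK; have := ler_wpM2r bt0 ue2; have := ler_wpM2r bt0 ue; lra.
have cE (i : 'I_d) : `|C i j - (B i j - beta0 * (v0 i 0 * dotF v0 cj))| <=
    e * `|B i j| + 34 * e * bt * `|v0 i 0|.
  have [p [pE CiE]] := CE i; set V := `|v0 i 0|; pose bV := bt * V.
  have V0 : 0 <= V by exact: normr_ge0.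
  have bV0 : 0 <= bV by rewrite mulr_ge0.
  have ebV0 : 0 <= e * bV by rewrite mulr_ge0.
  have h1 : `|t' * v i 0 - beta0 * (v0 i 0 * dotF v0 cj)| <= 30 * e * bV.
    have -> : t' * v i 0 - beta0 * (v0 i 0 * dotF v0 cj) =
      (t' - beta0 * dotF v0 cj) * (v i 0 - v0 i 0) +
        (t' - beta0 * dotF v0 cj) * v0 i 0
      + beta0 * dotF v0 cj * (v i 0 - v0 i 0) by ring.
    apply: le_trans (ler_normD _ _) _.
    have := ler_normD ((t' - beta0 * dotF v0 cj) * (v i 0 - v0 i 0))
      ((t' - beta0 * dotF v0 cj) * v0 i 0).
    have h0 : `|beta0 * dotF v0 cj| <=
      bt by rewrite normrM (ger0_norm b0) ler_wpM2l.
    rewrite [`|_ * (v i 0 - _)|]normrM [`|_ * v0 i 0|]normrM -/V.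
    rewrite [`|beta0 * _ * (v i 0 - _)|]normrM.
    have := ler_pM (normr_ge0 _) (normr_ge0 _) t'E (vE i).
    have := ler_pM (normr_ge0 _) (normr_ge0 _) h0 (vE i).
    have := ler_wpM2r V0 t'E; have := ler_wpM2r bV0 ee; move: ebV0;
      rewrite /bV -/V; lra.
  have h2 : `|beta0 * (v0 i 0 * dotF v0 cj)| <= bV.
    rewrite !normrM (ger0_norm b0) -/V /bV /bt.
    by have := ler_wpM2l b0 (ler_wpM2l V0 t0); lra.
  have h3 : `|p - beta0 * (v0 i 0 * dotF v0 cj)| <= 32 * e * bV.
    have h4 : `|t' * v i 0| <= (1 + 30 * e) * bV.
      have := ler_normD (t' * v i 0 - beta0 * (v0 i 0 * dotF v0 cj)) (beta0 *
        (v0 i 0 * dotF v0 cj)).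
      rewrite subrK; lra.
    have := rounds_err pE; have := ler_wpM2l u0 h4.
    have := ler_normD (p - t' * v i 0) (t' * v i 0 - beta0 * (v0 i 0 * dotF v0
      cj)).
    rewrite addrA subrK; have := ler_wpM2r bV0 ue2; have := ler_wpM2r bV0 ue;
      lra.
  have h4 : `|B i j - p| <= `|B i j| + (1 + 32 * e) * bV.
    have := ler_normB (B i j) p.
    have := ler_normD (p - beta0 * (v0 i 0 * dotF v0 cj)) (beta0 * (v0 i 0 *
      dotF v0 cj)).
    rewrite subrK; lra.
  have := rounds_err CiE; have := ler_wpM2l u0 h4.
  have := ler_normD (C i j - (B i j - p)) (B i j - p - (B i j - beta0 * (v0 i 0
    * dotF v0 cj))).
  rewrite addrA subrK (_ : B i j - p - _ = - (p - beta0 * (v0 i 0 * dotF v0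
    cj))); last by ring.
  rewrite normrN; have := ler_wpM2r (normr_ge0 (B i j)) ue.
  have := ler_wpM2r bV0 ue2; have := ler_wpM2r bV0 ue.
  rewrite (_ : 34 * e * bt * V = 34 * (e * bV)); last by rewrite /bV; ring.
  lra.
apply: le_trans (_ : nF (e *: absmx cj + (34 * e * bt) *: absmx v0) <= _).
  apply: normF_le_entries => i k; rewrite (ord1 k) [col _ _ _ _]mxE.
  have -> : (C - reflection v0 beta0 *m B) i j =
      C i j - (B i j - beta0 * (v0 i 0 * dotF v0 cj)).
    by rewrite [LHS]mxE [X in _ + X = _]mxE reflectionE.
  apply: le_trans (cE i) _; rewrite !mxE; exact: ler_norm.
apply: le_trans (normFD _ _) _.
rewrite !normFZ !normF_abs (ger0_norm e0) ger0_norm ?mulr_ge0//.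
have : bt * nF v0 <= 2 * nF cj.
  by have := ler_wpM2r (normF_ge0 cj) bv; rewrite -sqr_normF /bt /tau; lra.
by move=> /(ler_wpM2l e0); have := mulr_ge0 e0 (normF_ge0 cj); lra.
Qed.

(** The sign of [s0] is that of the first entry of [x], so [x + s0 e_0] is
    formed without cancellation. *)
Lemma fl_reflector_err d (x v : 'cV[R]_d.+1) s beta e :
  u <= e -> gam u d.+2 <= e -> e <= 1 / 1000 -> fl_reflector u x s v beta ->
  exists (v0 : 'cV[R]_d.+1) (s0 beta0 : R),
    [/\ (forall i, near_rel (5 * e) (v0 i 0) (v i 0)),
        near_rel (14 * e) beta0 beta /\ 0 <= beta0,
        beta0 * dotF v0 v0 = 2 \/ beta0 = 0,
        `|s - s0| <= 3 * e * nF x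
      & reflection v0 beta0 *m x = - s0 *: delta_mx 0 0].
Proof.
move=> ue ge e3 [q [r [w [qE rE sE [v0E vE] [wE bE]]]]];
  have e0 := le_trans u0 ue.
have ee : e * e <= 1 / 1000 * e by rewrite ler_wpM2r.
have ue2 : u * e <= 1 / 1000 * e by rewrite ler_wpM2r// (le_trans ue).
set r0 := nF x; have r00 : 0 <= r0 by exact: normF_ge0.
have {}qE : `|q - r0 ^+ 2| <= e * r0 ^+ 2.
  rewrite sqr_normF; apply: le_trans (fl_dot_err_normF u0 qE) _.
  by rewrite -expr2 sqr_normF ler_wpM2r// -sqr_normF sqr_ge0.
have q0 : 0 <= q.
  have := ler_norm (r0 ^+ 2 - q); rewrite distrC; have := sqr_ge0 r0.
  by move: qE; nra.
have sqE : near_rel e r0 (Num.sqrt q).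
  rewrite /near_rel (ger0_norm r00); have [r00'|rn] := eqVneq r0 0.
    move: qE; rewrite r00' expr2 !mulr0 normr_le0 subr0 => /eqP ->.
    by rewrite sqrtr0 subrr normr0.
  have rp : 0 < r0 by rewrite lt_neqAle eq_sym rn.
  have sq0 := sqrtr_ge0 q.
  rewrite -(ler_pM2r rp); apply: le_trans (_ :
    `|Num.sqrt q - r0| * (Num.sqrt q + r0) <= _).
    by rewrite ler_wpM2l// lerDr.
  rewrite -[Num.sqrt q + r0]ger0_norm ?addr_ge0// -normrM -subr_sqr sqr_sqrtr//.
  by rewrite -mulrA -expr2.
have {sqE}rE : `|r - r0| <= 3 * e * r0.
  rewrite -{2}(ger0_norm r00); apply: (near_rel_rounds _ _ sqE rE) => //; lra.
pose s0 := if x 0 0 < 0 then - r0 else r0.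
have ss0 : `|s - s0| <= 3 * e * r0.
  by rewrite sE /s0; case: ifP => _ //; rewrite opprK addrC distrC.
have s0n : `|s0| = r0 by rewrite /s0; case: ifP => _; rewrite ?normrN ger0_norm.
have s02 : s0 ^+ 2 = r0 ^+ 2 by rewrite /s0; case: ifP => _ //; rewrite sqrrN.
have s0x : 0 <= s0 * x 0 0.
  rewrite /s0; case: ltP => x0; last by rewrite mulr_ge0.
  by rewrite mulNr -mulrN mulr_ge0// oppr_ge0 ltW.
pose v0 := x + s0 *: delta_mx 0 0; pose beta0 := 1 / (s0 * v0 0 0).
have v00 : v0 0 0 = x 0 0 + s0 by rewrite !mxE mulr1.
have v0i i : i != 0 -> v0 i 0 = x i 0.
  by move=> i0; rewrite !mxE (negPf i0) mulr0 addr0.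
have r0v : r0 <= `|v0 0 0|.
  rewrite v00 /s0; case: ltP => x0.
    by have := ler_norm (- (x 0 0 - r0)); rewrite normrN; lra.
  by have := ler_norm (x 0 0 + r0); lra.
have vn i : near_rel (5 * e) (v0 i 0) (v i 0).
  have [->|i0] := eqVneq i 0; last first.
    by rewrite /near_rel vE// v0i// subrr normr0 !mulr_ge0.
  apply: (near_rel_rounds _ _ _ v0E (a := 3 * e)); rewrite ?mulr_ge0//;
    first lra.
  rewrite /near_rel {1}v00 opprD addrACA subrr add0r.
  by apply: le_trans ss0 _; rewrite ler_wpM2l// mulr_ge0.
have sn : near_rel (3 * e) s0 s by rewrite /near_rel s0n.
have wn : near_rel (11 * e) (s0 * v0 0 0) w.
  apply: (near_rel_rounds _ _ (near_relM _ _ sn (vn 0) (c := 9 * e)) wE);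
    rewrite ?mulr_ge0//; lra.
have bn : near_rel (14 * e) beta0 beta.
  have winv : near_rel (12 * e) beta0 (1 / w).
    rewrite /beta0 !div1r; apply: near_relV wn; rewrite ?mulr_ge0//; lra.
  apply: (near_rel_rounds _ _ winv bE); rewrite ?mulr_ge0//; lra.
have s0v0 : s0 * v0 0 0 = r0 ^+ 2 +
  s0 * x 0 0 by rewrite v00 mulrDr -expr2 s02 addrC.
have s0v00 : 0 <= s0 * v0 0 0 by rewrite s0v0 addr_ge0// sqr_ge0.
have dd (y : 'cV[R]_d.+1) : dotF (delta_mx 0 0) y = y 0 0.
  rewrite dotFE (bigD1 0)//= big_ord1 !mxE /= mul1r big1 ?addr0// => i i0.
  by rewrite big_ord1 mxE (negPf i0) mul0r.
have v0x : dotF v0 x = s0 * v0 0 0.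
  by rewrite dotFDl dotFZl dd -sqr_normF s0v0.
have v0v0 : dotF v0 v0 = 2 * (s0 * v0 0 0).
  rewrite {2}/v0 dotFDr v0x dotFZr dotFC dd; ring.
exists v0, s0, beta0; split=> //.
- by split=> //; rewrite divr_ge0.
- have [z|nz] := eqVneq (s0 * v0 0 0) 0; [right|left].
    by rewrite /beta0 z invr0 mulr0.
  by rewrite v0v0 /beta0 div1r mulrCA mulVf // mulr1.
have hx : reflection v0 beta0 *m x = x - (beta0 * (s0 * v0 0 0)) *: v0.
  apply/matrixP => i j; rewrite (ord1 j) reflectionE; set y := dotF _ _.
  have -> : y = s0 * v0 0 0.
    by rewrite -v0x; congr dotF; apply/matrixP => k l; rewrite (ord1 l) mxE.
  by rewrite [RHS]mxE [X in _ = _ +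
    X]mxE [X in _ = _ - X]mxE mulrA mulrAC -mulrA.
have [z|nz] := eqVneq (s0 * v0 0 0) 0.
  have /eqP : r0 ^+ 2 = 0.
    by apply/eqP; move: (sqr_ge0 r0) (s0v0) s0x;
      rewrite z le_eqVlt => /orP[/eqP <-//|]; lra.
  rewrite sqrf_eq0 => /eqP r00'; have x0 := normF0_eq0 r00'.
  have -> : s0 = 0 by apply/eqP; rewrite -normr_eq0 s0n r00'.
  by rewrite x0 mulmx0 oppr0 scale0r.
rewrite hx /beta0 mul1r mulVf// scale1r /v0 opprD addrA subrr add0r scaleNr.
by [].
Qed.

(** The exact reflection near the computed one depends on the computed
    reflector alone: one matrix [H] serves all the blocks it is applied to. *)
Lemma fl_householder d (x v : 'cV[R]_d.+1) s beta e :
  u <= e -> gam u d.+2 <= e -> e <= 1 / 1000 -> fl_reflector u x s v beta ->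
  exists H : 'M[R]_d.+1,
    [/\ H^T = H, H *m H = 1%:M,
        nF (H *m x + s *: delta_mx 0 0) <= 3 * e * nF x
      & forall n (B C : 'M[R]_(d.+1, n)), fl_reflect u v beta B C ->
          nF (C - H *m B) <= 70 * e * nF B].
Proof.
move=> ue ge e3 /fl_reflector_err-/(_ e ue ge e3).
case=> v0 [s0 [beta0 [vE [bE b0] vb ss0 Hx]]].
have := reflection_orth vb; rewrite reflection_tr => HH.
exists (reflection v0 beta0); split=> //; first exact: reflection_tr.
  rewrite Hx scaleNr addrC -scalerBl normFZ; apply: le_trans ss0.
  suff -> : nF (delta_mx 0 0 : 'cV[R]_d.+1) = 1 by rewrite mulr1.
  rewrite normFE dotFE (bigD1 0)//= big_ord1 !mxE /= mul1r big1 ?addr0 ?sqrtr1//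
    => i i0.
  by rewrite big_ord1 mxE (negPf i0) mul0r.
move=> n B C; apply: fl_reflect_err => //.
by case: vb => ->; rewrite ?mul0r.
Qed.

End Householder.

(** * Rounding errors of Householder QR *)

Section QR.
Context {R : realType}.

Lemma normF_row_le m p n1 n2 (B : 'M[R]_(m, n1)) (C : 'M[R]_(m, n2))
    (B' : 'M[R]_(p, n1)) (C' : 'M[R]_(p, n2)) a : 0 <= a ->
  nF B <= a * nF B' -> nF C <= a * nF C' ->
  nF (row_mx B C) <= a * nF (row_mx B' C').
Proof.
move=> a0 BB CC; apply: normF_le => //; rewrite !dotF_row mulrDr.
by apply: lerD; rewrite -!sqr_normF -exprMn ler_pXn2r ?nnegrE ?mulr_ge0.
Qed.

Lemma normF_col0 m1 m2 n (B : 'M[R]_(m2, n)) :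
  nF (col_mx (0 : 'M_(m1, n)) B) = nF B.
Proof. by rewrite !normFE dotF_col dotF0r add0r. Qed.

Lemma normF_row0 m n1 n2 (B : 'M[R]_(m, n2)) :
  nF (row_mx (0 : 'M_(m, n1)) B) = nF B.
Proof. by rewrite !normFE dotF_row dotF0r add0r. Qed.

Lemma normF_dsubmx m1 m2 n (B : 'M[R]_(m1 + m2, n)) : nF (dsubmx B) <= nF B.
Proof.
rewrite -(@ler_pXn2r _ 2) ?nnegrE// !sqr_normF -[in leRHS](vsubmxK B) dotF_col.
by rewrite lerDr -sqr_normF sqr_ge0.
Qed.

Lemma row_mxB_block m1 m2 n1 n2 (X : 'M[R]_(m1 + m2, n1)) (Y :
  'M_(_, n2)) B C D E :
  row_mx X Y - block_mx B C D E = row_mx (X - col_mx B D) (Y - col_mx C E).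
Proof. by rewrite block_mxEh opp_row_mx add_row_mx. Qed.

Lemma block_upper_triangular n (a : 'M[R]_1) (r : 'rV_n) (T : 'M_n) :
  (forall i j : 'I_n, (j < i)%N -> T i j = 0) ->
  forall i j : 'I_(1 + n), (j < i)%N -> block_mx a r 0 T i j = 0.
Proof.
move=> T0 i j; case: (split_ordP i) => k ->; case: (split_ordP j) => l -> /=.
- by rewrite (ord1 k) ltn0.
- by rewrite (ord1 k) ltn0.
- by move=> _; rewrite block_mxEdl mxE.
- by rewrite block_mxEdr ltn_add2l; exact: T0.
Qed.

(** The exact reflections preserve norms, so the errors of the successive steps
    do not amplify each other. The columns of [Q0] are the first columns of
    the product of these reflections: the same matrix is close to the computed
    Q-factor and factors a matrix close to [A], which is what allows both to be
    used in the initial solve. *)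
Lemma fl_qr_err (u e : R) d n (A Q : 'M[R]_(d, n)) (T : 'M[R]_n) :
  0 <= u -> u <= e -> gam u d.+1 <= e -> e <= 1 / 1000 -> fl_qr u A Q T ->
  exists Q0 : 'M[R]_(d, n),
    [/\ Q0^T *m Q0 = 1%:M,
        nF (A - Q0 *m T) <= gam (70 * e) n * nF A,
        nF (Q - Q0) <= n%:R * gam (70 * e) n
      & forall i j : 'I_n, (j < i)%N -> T i j = 0].
Proof.
move=> u0 ue ge e3; have e0 := le_trans u0 ue.
have g0 : 0 <= 70 * e by rewrite mulr_ge0.
elim: n d A Q T ge => [|n IH] [|d] //= A Q T ge.
- move=> _; exists Q; split=> [|||[]//]; first by apply/matrixP => -[].
    by rewrite (thinmx0 (_ - _)) normF0 mulr_ge0// gam_ge0.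
  by rewrite subrr normF0 mul0r.
- move=> _; exists Q; split=> [|||[]//]; first by apply/matrixP => -[].
    by rewrite (thinmx0 (_ - _)) normF0 mulr_ge0// gam_ge0.
  by rewrite subrr normF0 mul0r.
case=> s [beta [v [B [Q' [T' [xE BE QR ->  QE]]]]]].
have [Q1 [Q1o AE Q'E T'u]] :=
  IH _ _ _ _ (le_trans (ler_gam u0 (leqnSn _)) ge) QR.
have [H [HT HH Hx HE]] := fl_householder u0 ue ge e3 xE.
have Ho : H^T *m H = 1%:M by rewrite HT.
have {}BE := HE _ _ _ BE; have {}QE := HE _ _ _ QE.
set P := gam (70 * e) n in AE Q'E; have P0 : 0 <= P by exact: gam_ge0.
pose D (M : 'M[R]_(d, n)) : 'M_(1 + d, 1 + n) := block_mx 1%:M 0 0 M.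
have DB (M N : 'M[R]_(d, n)) : nF (D M - D N) = nF (M - N).
  rewrite /D opp_block_mx add_block_mx !oppr0 !addr0 subrr /block_mx.
  by rewrite row_mx0 normF_col0 normF_row0.
set A1 := lsubmx _ in xE Hx; set A2 := rsubmx _ in BE.
have A_row : A = row_mx A1 A2 by rewrite hsubmxK.
have Do : (D Q1)^T *m D Q1 = 1%:M.
  rewrite /D tr_block_mx !trmx0 trmx1 mulmx_block !mulmx0 !mul0mx !addr0 add0r.
  by rewrite mul1mx Q1o -scalar_mx_block.
exists (H *m D Q1); split.
- by rewrite trmx_mul -mulmxA (mulmxA H^T) Ho mul1mx; exact: Do.
- set W := block_mx (- s)%:M (usubmx B) 0 (Q1 *m T').
  have -> : H *m D Q1 *m block_mx (- s)%:M (usubmx B) 0 T' = H *m W.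
    rewrite -mulmxA; congr (H *m _); rewrite /W /D.
    rewrite [LHS](mulmx_block 1%:M 0 0 Q1 (- s)%:M (usubmx B) 0 T').
    by rewrite !mul1mx !mul0mx !mulmx0 !addr0 !add0r.
  rewrite -(normF_orth _ Ho) mulmxBr mulmxA HH mul1mx.
  have -> : H *m A - W = row_mx (H *m A1 + s *: delta_mx 0 0)
      (H *m A2 - col_mx (usubmx B) (Q1 *m T')).
    have -> : H *m A = row_mx (H *m A1) (H *m A2).
      by rewrite [in LHS]A_row; exact: (mul_mx_row H A1 A2).
    apply: eq_trans (row_mxB_block (H *m A1 : 'M_(1 + d, _))
      (H *m A2 : 'M_(1 + d, _)) (- s)%:M (usubmx B) 0 (Q1 *m T')) _.
    congr (row_mx (_ + _) _); apply/matrixP => i j;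
      rewrite (ord1 j) [LHS]mxE [RHS]mxE.
    rewrite [X in _ = _ * X]mxE andbT; case: (split_ordP i) => k ->.
      by rewrite col_mxEu (ord1 k) !mxE /= mulr1 opprK.
    by rewrite col_mxEd mxE /= mulr0 oppr0.
  rewrite [in leRHS]A_row; apply: (@normF_row_le (1 + d) (1 + d) 1 n);
    first exact: gam_ge0.
    apply: le_trans Hx _; rewrite ler_wpM2r// gamS -/P.
    have := mulr_ge0 g0 P0; lra.
  have h1 : nF (B - col_mx (usubmx B) (Q1 *m T')) <= P * nF B.
    rewrite -{1}(vsubmxK B) opp_col_mx add_col_mx subrr normF_col0.
    by apply: le_trans AE _; rewrite ler_wpM2l// normF_dsubmx.
  have h2 : nF B <= (1 + 70 * e) * nF (A2).
    have := normFD (B - H *m A2) (H *m A2).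
    rewrite subrK (normF_orth _ Ho); lra.
  have := normFD (H *m A2 - B) (B - col_mx (usubmx B) (Q1 *m T')).
  rewrite addrA subrK (normFC _ B); have := ler_wpM2l P0 h2; rewrite gamS -/P;
    lra.
- have h1 : nF (D Q') <= n.+1%:R + n%:R * P.
    have := normFD (D Q' - D Q1) (D Q1); rewrite subrK DB.
    have : nF (D Q1) <= n.+1%:R.
      by rewrite -[D Q1]mulmx1 normF_orth//; exact: normF1.
    lra.
  have h2 : nF (H *m D Q' - H *m D Q1) <= n%:R * P.
    by rewrite -mulmxBr normF_orth// DB.
  have := normFD (Q - H *m D Q') (H *m D Q' - H *m D Q1).
  rewrite addrA subrK; have := ler_wpM2l g0 h1; rewrite gamS -/P -natr1.
  have := mulr_ge0 g0 P0; lra.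
- by move=> i j; apply: block_upper_triangular.
Qed.

End QR.

(** * Backward error of an approximate least-squares solution *)

Section BackwardError.
Context {R : realType}.

Lemma normF_sqrB m n (B C : 'M[R]_(m, n)) :
  nF (B - C) ^+ 2 = nF B ^+ 2 - 2 * dotF B C + nF C ^+ 2.
Proof. by rewrite !sqr_normF dotFBl !dotFBr (dotFC C B); ring. Qed.

Lemma normal_equations_argmin m n (A : 'M[R]_(m, n)) b x :
  A^T *m (b - A *m x) = 0 -> is_argmin A b x.
Proof.
move=> Ar z; rewrite !euclideanE -(@ler_pXn2r _ 2) ?nnegrE//.
have -> : b - A *m z = (b - A *m x) - A *m (z - x).
  by rewrite mulmxBr opprB addrA subrK.
rewrite (normF_sqrB (b - A *m x)) dotF_mulr Ar dotFC dotF0r mulr0 subr0.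
by rewrite lerDl sqr_ge0.
Qed.

(** With [g = A^T r], moving from [x] by [t g] changes the square of the
    residual norm by [- 2 t |g|^2 + t^2 |A g|^2], which is negative for small
    [t] unless [g] vanishes. *)
Lemma argmin_normal_equations m n (A : 'M[R]_(m, n)) b x :
  is_argmin A b x -> A^T *m (b - A *m x) = 0.
Proof.
move=> xmin; set r := b - A *m x; set g := A^T *m r; apply: normF0_eq0.
pose C := nF A ^+ 2 + 1; have C0 : 0 < C by rewrite ltr_wpDl// sqr_ge0.
have := xmin (x + C^-1 *: g); rewrite !euclideanE -(@ler_pXn2r _ 2) ?nnegrE//.
have -> : b - A *m (x + C^-1 *: g) = r - C^-1 *: (A *m g).
  by rewrite mulmxDr opprD addrA -scalemxAr.
rewrite -/r (normF_sqrB r (C^-1 *: _)) dotFZr normFZ dotF_mulr -/g -sqr_normF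
  ger0_norm ?invr_ge0 ?(ltW C0)//.
have Ag : nF (A *m g) ^+ 2 <= C * nF g ^+ 2.
  apply: le_trans (_ : (nF A * nF g) ^+ 2 <= _).
    by rewrite ler_pXn2r ?nnegrE ?mulr_ge0// normFM.
  by rewrite exprMn ler_wpM2r ?sqr_ge0// lerDl.
have h : (C^-1 * nF (A *m g)) ^+ 2 <= C^-1 * nF g ^+ 2.
  rewrite exprMn expr2 -mulrA ler_pM2l ?invr_gt0//.
  by rewrite ler_pdivrMl.
move=> h2; have : C^-1 * nF g ^+ 2 <= 0 by lra.
rewrite pmulr_rle0 ?invr_gt0// => g0; apply/eqP; rewrite -sqrf_eq0.
by rewrite eq_le g0 sqr_ge0.
Qed.

Lemma backward_error_le m n (A DA : 'M[R]_(m, n)) b x :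
  is_argmin (A + DA) b x -> backward_error A b x <= nF DA.
Proof.
by move=> H; apply: ge_inf; [exists 0 => _ [E _ <-]|exists DA].
Qed.

Lemma normF_outer m n (a : 'cV[R]_m) (c : 'cV[R]_n) :
  nF (a *m c^T) <= nF a * nF c.
Proof. by rewrite -(normFT c) normFM. Qed.

Lemma outer_comb_tr m n a c (p s : 'cV[R]_m) (x w : 'cV[R]_n) :
  (a *: (p *m x^T) - c *: (s *m w^T))^T = a *: (x *m p^T) - c *: (w *m s^T).
Proof. by rewrite linearB /= !linearZ /= !trmx_mul !trmxK. Qed.

(** The perturbed problem is to have a residual [s] with [A + DA] orthogonal to
    [s] and [(A + DA) x = b - s]; these two conditions on [DA] are compatible
    exactly when [s] is orthogonal to [b - s]. The corrected residual
    [s0 = b - A x - A h] nearly has this property, and the scaling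
    [lam = (s0, b) / |s0|^2] achieves it. Then [DA] is a matrix of rank two
    that maps [x] to [b - A x - s] and whose transpose maps [s0] to
    [- A^T s0].

    If the residual itself is of order [eps |x|], then [s0] may vanish; but a
    perturbation of rank one and norm of order [eps] removes the residual. *)
Lemma backward_error_bound m n (A : 'M[R]_(m, n)) (b : 'cV_m) (x h :
  'cV_n) eps :
  x != 0 -> nF (A *m h) <= eps * nF x -> nF h <= nF x ->
  nF (A^T *m (b - A *m x - A *m h)) <= eps * nF (b - A *m x) ->
  backward_error A b x <= 9 * eps.
Proof.
move=> x0 Ah hx As; set r := b - A *m x in As *.
have xp : 0 < nF x by exact: normF_gt0.
have xx : dotF x x != 0 by rewrite -sqr_normF expf_neq0// gt_eqF.
have e0 : 0 <= eps by rewrite -(pmulr_lge0 _ xp) (le_trans _ Ah).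
(* In the second case the residual dominates [A h], so that [s0] is comparable
   to it. *)
have [small|big] := leP (nF r) (2 * (eps * nF x)).
  pose DA := (dotF x x)^-1 *: (r *m x^T).
  have DAx : DA *m x = r.
    by rewrite -scalemxAl -mulmxA col_dot mul_mx_scalar scalerA mulVf// scale1r.
  apply: le_trans (backward_error_le (DA := DA) _) _.
    apply: normal_equations_argmin.
    by rewrite mulmxDl DAx opprD addrA -/r subrr mulmx0.
  rewrite normFZ ger0_norm ?invr_ge0 -?sqr_normF ?sqr_ge0//.
  rewrite ler_pdivrMl ?exprn_gt0//; apply: le_trans (normF_outer _ _) _.
  have := ler_wpM2r (ltW xp) small;
    have := mulr_ge0 (mulr_ge0 e0 (ltW xp)) (ltW xp).
  by rewrite expr2; lra.
set s0 := r - A *m h in As.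
have rs0 : nF r <= 2 * nF s0.
  have := normFD s0 (A *m h); rewrite subrK; lra.
have s0p : 0 < nF s0 by have := mulr_ge0 e0 (ltW xp); lra.
have ss : dotF s0 s0 != 0 by rewrite -sqr_normF expf_neq0// gt_eqF.
pose lam := dotF s0 b / dotF s0 s0; pose s := lam *: s0.
have lamE : dotF s0 s = dotF s0 b by rewrite dotFZr mulfVK.
have ds : nF (s0 - s) <= 4 * (eps * nF x).
  have h1 : (1 - lam) * dotF s0 s0 = - dotF (A^T *m s0) (x + h).
    rewrite mulrBl mul1r mulfVK// -dotF_mulr -dotFBr -dotFNr; congr dotF.
    by rewrite /s0 /r mulmxDr; apply/matrixP => i j; rewrite !mxE; ring.
  have h2 : `|1 - lam| * nF s0 ^+ 2 <= (eps * nF r) * (2 * nF x).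
    rewrite -[nF s0 ^+ 2]ger0_norm ?sqr_ge0// -normrM sqr_normF h1 normrN.
    apply: le_trans (dotF_le _ _) _; rewrite ler_pM//.
    by have := normFD x h; lra.
  rewrite -[s0 in s0 - s]scale1r -scalerBl normFZ -(ler_pM2r s0p).
  apply: le_trans (_ : `|1 - lam| * nF s0 ^+ 2 <= _);
    first by rewrite expr2 mulrA.
  have := ler_wpM2l (mulr_ge0 e0 (ltW xp)) rs0; lra.
pose q := A^T *m s0; pose p := r - s.
pose DA := (dotF x x)^-1 *: (p *m x^T)
  - (dotF s0 s0)^-1 *: (s0 *m (q - (dotF q x / dotF x x) *: x)^T).
have qx : dotF (q - (dotF q x / dotF x x) *: x) x = 0.
  by rewrite dotFBl dotFZl mulfVK// subrr.
have DAx : DA *m x = p.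
  rewrite mulmxBl -!scalemxAl -!mulmxA !col_dot qx !mul_mx_scalar scale0r
    scaler0 subr0.
  by rewrite scalerA mulVf// scale1r.
have pE : nF p <= 5 * (eps * nF x).
  have -> : p = A *m h + (s0 - s) by rewrite /p /s0 addrA addrCA subrr addr0.
  have := normFD (A *m h) (s0 - s); lra.
apply: le_trans (backward_error_le (DA := DA) _) _.
  apply: normal_equations_argmin.
  have -> : b - (A + DA) *m x = s.
    by rewrite mulmxDl DAx opprD addrA -/r /p opprB addrC subrK.
  rewrite /s -scalemxAr (_ : (A + DA)^T *m s0 = 0) ?scaler0//.
  have -> : (A + DA)^T = A^T + DA^T by rewrite linearD.
  rewrite mulmxDl -/q /DA outer_comb_tr.
  rewrite mulmxBl -!scalemxAl -!mulmxA !col_dot !mul_mx_scalar !scalerA.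
  rewrite mulVf// scale1r -scalerA.
  have -> : dotF p s0 = - dotF q x.
    rewrite dotFBl (dotFC s) lamE dotFC -dotFBr /q dotF_mull trmxK -dotFNr.
    by congr dotF; rewrite /r addrAC subrr add0r.
  by rewrite scaleNr scalerN scalerA mulrC; apply/matrixP => i j; rewrite !mxE;
    ring.
apply: le_trans (normFB _ _) _;
  rewrite !normFZ !ger0_norm ?invr_ge0 -?sqr_normF ?sqr_ge0//.
rewrite (_ : 9 * eps = 5 * eps + 4 * eps); last by ring.
apply: lerD; rewrite ler_pdivrMl ?exprn_gt0//;
  apply: le_trans (normF_outer _ _) _.
  have := ler_wpM2r (ltW xp) pE; rewrite expr2; lra.
have w2 : nF (q - (dotF q x / nF x ^+ 2) *: x) <= 2 * nF q.
  apply: le_trans (normFB _ _) _; rewrite normFZ normrM normfV.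
  rewrite (ger0_norm (sqr_ge0 (nF x))) mulrAC.
  have : `|dotF q x| * nF x / nF x ^+ 2 <= nF q.
    rewrite ler_pdivrMr ?exprn_gt0//.
    by have := ler_wpM2r (ltW xp) (dotF_le q x); rewrite expr2; lra.
  lra.
have q2 : nF q <= eps * (2 * nF s0) by apply: le_trans As _; rewrite ler_wpM2l.
have := ler_wpM2l (ltW s0p) w2; have := ler_wpM2l (ltW s0p) q2.
rewrite expr2; lra.
Qed.

End BackwardError.

(** * Propagation of errors through iterative refinement *)

Section Refinement.
Context {R : realType}.

Lemma injective_unitmx n (T : 'M[R]_n) :
  (forall v : 'cV_n, T *m v = 0 -> v = 0) -> T \in unitmx.
Proof.
move=> Tinj; rewrite -unitmx_tr -row_free_unit -kermx_eq0;
  apply/eqP/row_matrixP => i.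
rewrite row0; apply: trmx_inj; rewrite trmx0; apply: Tinj.
apply: trmx_inj; rewrite trmx_mul trmxK trmx0;
  exact: (sub_kermxP (row_sub i _)).
Qed.

(** An error bounded by the sum of two contributions can be attributed to them
    in parts. *)
Lemma normF_split n (q : 'cV[R]_n) a c : 0 <= a -> 0 <= c -> nF q <= a + c ->
  exists q1 q2, [/\ q = q1 + q2, nF q1 <= a & nF q2 <= c].
Proof.
move=> a0 c0 qac; have [ac|ac] := eqVneq (a + c) 0.
  exists 0, 0; rewrite normF0 addr0; split=> //; apply: normF0_eq0.
  by apply: le_anti; rewrite normF_ge0 -ac qac.
have acp : 0 < a + c by rewrite lt_neqAle eq_sym ac addr_ge0.
exists ((a / (a + c)) *: q), ((c / (a + c)) *: q); split.
- by rewrite -scalerDl -mulrDl mulfV// scale1r.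
- rewrite normFZ ger0_norm ?divr_ge0 ?(ltW acp)// mulrAC ler_pdivrMr//.
  by rewrite ler_wpM2l.
- rewrite normFZ ger0_norm ?divr_ge0 ?(ltW acp)// mulrAC ler_pdivrMr//.
  by rewrite ler_wpM2l.
Qed.

Definition preconditioned m n (A : 'M[R]_(m, n)) (T : 'M[R]_n) : 'M[R]_n :=
  (invmx T)^T *m A^T *m A *m invmx T.

(** One refinement step in which each computed operation is only known through
    a normwise error bound. *)
Definition refine_errors (kappa U : R) m n (A : 'M[R]_(m, n)) (T : 'M[R]_n)
    (b : 'cV[R]_m) (xh x' : 'cV[R]_n) : Prop :=
  exists (y r : 'cV[R]_m) (g c dy w : 'cV[R]_n),
    [/\ nF (y - A *m xh) <= U * nF xh /\ nF (r - (b - y)) <= U * nF (b - y),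
        nF (g - A^T *m r) <= U * nF r /\ nF (T^T *m c - g) <= U * nF c,
        nF (dy - invmx (preconditioned A T) *m c) <= kappa * U * nF c,
        nF (T *m w - dy) <= U * nF w
      & nF (x' - (xh + w)) <= U * nF (xh + w)].

Variables (m n : nat) (A : 'M[R]_(m, n)) (T : 'M[R]_n).
Variables (b : 'cV[R]_m) (x : 'cV[R]_n) (kappa U : R).
Hypothesis A_le : forall v : 'cV_n, nF (A *m v) <= nF v.
Hypothesis A_ge : forall v : 'cV_n, nF v <= kappa * nF (A *m v).
Hypothesis T_ge : forall v : 'cV_n, nF (A *m v) <= 20 * nF (T *m v).
Hypothesis kappa_ge1 : 1 <= kappa.
Hypothesis U_ge0 : 0 <= U.
Hypothesis kappaU_small : kappa * U <= 1 / 10 ^+ 6.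
Hypothesis x_normal : A^T *m (b - A *m x) = 0.

Let AT_le (w : 'cV_m) : nF (A^T *m w) <= nF w.
Proof.
have A_le1 (v : 'cV_n) : nF (A *m v) <= 1 * nF v by rewrite mul1r; exact: A_le.
by have := normF_opT ler01 A_le1 w; rewrite mul1r.
Qed.

Let kappa_ge0 : 0 <= kappa. Proof. exact: le_trans kappa_ge1. Qed.
Let omega_ge0 : 0 <= kappa * U. Proof. exact: mulr_ge0. Qed.
Let U_le_omega : U <= kappa * U. Proof. by rewrite ler_peMl. Qed.

Let A_inj (v : 'cV_n) : A *m v = 0 -> v = 0.
Proof.
by move=> Av; apply: normF0_eq0; apply: le_anti; rewrite normF_ge0 andbT;
  have := A_ge v; rewrite Av normF0 mulr0.
Qed.

Let gram_unit : A^T *m A \in unitmx.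
Proof.
apply: injective_unitmx => v Gv; apply: A_inj; apply: normF0_eq0.
by apply/eqP; rewrite -sqrf_eq0 -dotF_gram Gv dotF0r.
Qed.

Let T_unit : T \in unitmx.
Proof.
apply: injective_unitmx => v Tv; apply: A_inj; apply: normF0_eq0.
by apply: le_anti; rewrite normF_ge0 andbT; have := T_ge v;
  rewrite Tv normF0 mulr0.
Qed.

(** Perturbing the right-hand side [p] of the least-squares problem costs no
    condition number in the norm [|A k|]; perturbing the normal equations
    costs one. *)
Lemma normal_solve_bound (k q : 'cV_n) (p : 'cV_m) :
  A^T *m A *m k = A^T *m p + q -> nF (A *m k) <= nF p + kappa * nF q.
Proof.
move=> kE; have [->|/normF_gt0 Ak] := eqVneq (A *m k) 0.
  by rewrite normF0 addr_ge0// mulr_ge0.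
rewrite -(ler_pM2l Ak) -expr2 -dotF_gram kE dotFDr -dotF_mull.
have := dotF_le_norm (A *m k) p; have := dotF_le_norm k q.
have := ler_wpM2r (normF_ge0 q) (A_ge k); lra.
Qed.

(** The inverse transpose of [T] may have a norm as large as [kappa], but here
    it is applied to the range of [A^T], and [A T^-1] is bounded. *)
Lemma transposed_solve_bound (c v : 'cV_n) :
  T^T *m c = A^T *m A *m v -> nF c <= 20 * nF (A *m v).
Proof.
move=> cE; have [->|/normF_gt0 c0] := eqVneq c 0;
  first by rewrite normF0 mulr_ge0.
rewrite -(ler_pM2l c0) -expr2 sqr_normF.
have cT : c = T *m (invmx T *m c) by rewrite mulmxA mulmxV// mul1mx.
rewrite {1}cT dotF_mull cE -mulmxA -dotF_mull.
apply: le_trans (dotF_le_norm _ _) _.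
by have := ler_wpM2r (normF_ge0 (A *m v)) (T_ge (invmx T *m c)); rewrite -cT;
  lra.
Qed.

Lemma preconditioned_solve (c : 'cV_n) :
  A^T *m A *m (invmx T *m (invmx (preconditioned A T) *m c)) = T^T *m c.
Proof.
have Gu : preconditioned A T \in unitmx.
  by rewrite /preconditioned -(mulmxA _ A^T A) !unitmx_mul unitmx_tr !unitmx_inv
    T_unit gram_unit.
have GT : T^T *m preconditioned A T = A^T *m A *m invmx T.
  by rewrite /preconditioned !mulmxA -trmx_mul mulVmx// trmx1 mul1mx.
by rewrite (mulmxA (A^T *m A) (invmx T)) -GT -mulmxA (mulmxA (preconditioned A
  T)) mulmxV// mul1mx.
Qed.

(** The error after one refinement step is [k + l]: [k] solves perturbed normal
    equations, and [l] collects the errors made from the inner solve on. In the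
    perturbation, [p1] comes from the product [A xh], [p2] from the formation
    of the residual and of its image under [A^T], and [p3] from the transposed
    triangular solve. They are kept apart because the bound of [p2] alone
    contains the norm of the residual. *)
Lemma refine_error_split xh x' : refine_errors kappa U A T b xh x' ->
  let al := nF (A *m (x - xh)) in
  let rho := nF (b - A *m x) in
  exists (k l p2 p3 : 'cV_n) (p1 : 'cV_m),
    [/\ x' - x = k + l,
        A^T *m A *m k = A^T *m p1 + p2 + p3,
        nF p1 <= U * (nF x + kappa * al)
        /\ nF p2 <= 3 * U * (rho + (al + U * (nF x + kappa * al))),
        nF p3 <= 20 * U * (al + nF (A *m k))
      & nF (A *m l) <= U * nF x + 500 * (kappa * U * (al + nF (A *m k)))].
Proof.
case=> y [r [g [c [dy [w [[yE rE] [gE cE] dyE wE x'E]]]]]] al rho.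
set z := invmx (preconditioned A T) *m c in dyE; pose e := x - xh.
pose k := invmx T *m z - e.
pose f1 := y - A *m xh; pose f2 := r - (b - y); pose f3 := g - A^T *m r.
pose f4 := T^T *m c - g; pose f5 := dy - z; pose f6 := T *m w - dy.
pose f7 := x' - (xh + w); pose l' := invmx T *m (f5 + f6).
have Tl' : T *m l' = f5 + f6 by rewrite mulmxA mulmxV// mul1mx.
have wk : w = e + k + l'.
  have f56 : f5 + f6 = T *m w - z by rewrite /f5 /f6 addrC addrA subrK.
  rewrite /l' f56 mulmxBr mulmxA mulVmx// mul1mx /k (addrC e) subrK.
  by rewrite addrC subrK.
have Ae : nF (A *m e) = al by [].
have xh_le : nF xh <= nF x + kappa * al.
  have -> : xh = x - e by rewrite /e opprB addrC subrK.
  by apply: le_trans (normFB _ _) _; rewrite lerD2l -Ae.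
have F1 : nF f1 <= U * (nF x + kappa * al).
  by apply: le_trans yE _; rewrite ler_wpM2l.
have by_le : nF (b - y) <= rho + al + nF f1.
  have -> : b - y = (b - A *m x) + A *m e - f1.
    by rewrite /e /f1 mulmxBr; apply/matrixP => i j; rewrite !mxE; ring.
  have := normFB (b - A *m x + A *m e) f1; have := normFD (b - A *m x) (A *m e).
  by rewrite Ae -/rho; lra.
have F2 : nF f2 <= U * (rho + al + nF f1).
  by apply: le_trans rE _; rewrite ler_wpM2l.
have r_le : nF r <= rho + al + nF f1 + nF f2.
  have := normFD (b - y) f2; rewrite addrC subrK; lra.
have F3 : nF f3 <= U * (rho + al + nF f1 + nF f2).
  by apply: le_trans gE _; rewrite ler_wpM2l.
have cAk : T^T *m c = A^T *m A *m (k +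
  e) by rewrite /k subrK preconditioned_solve.
have Cn : nF c <= 20 * (al + nF (A *m k)).
  apply: le_trans (transposed_solve_bound cAk) _; rewrite ler_wpM2l// mulmxDr.
  by apply: le_trans (normFD _ _) _; rewrite Ae addrC.
have al0 : 0 <= al by exact: normF_ge0.
have rho0 : 0 <= rho by exact: normF_ge0.
set a := nF (A *m k) in Cn *; have a0 : 0 <= a by exact: normF_ge0.
exists k, (l' + f7), (A^T *m f2 + f3), f4, (- f1); split.
- rewrite (_ : x' = xh + w + f7); last by rewrite addrC subrK.
  by rewrite wk /e; apply/matrixP => i j; rewrite !mxE; ring.
- apply: (addIr (A^T *m A *m e)); rewrite -mulmxDr -cAk.
  rewrite (_ : T^T *m c = f4 + (f3 + A^T *m r)); last by rewrite !subrK.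
  have -> : r = f2 - f1 + (b - A *m x) + A *m e.
    by rewrite /f2 /f1 /e mulmxBr; apply/matrixP => i j; rewrite !mxE; ring.
  rewrite mulmxDr mulmxDr x_normal addr0 mulmxA mulmxBr mulmxN.
  by apply/matrixP => i j; rewrite !mxE; ring.
- split; first by rewrite normFN.
  apply: le_trans (normFD _ _) _; have := AT_le f2.
  set F := U * (nF x + kappa * al) in F1 *.
  have U1 : U <= 1 / 10 ^+ 6 by apply: le_trans kappaU_small.
  have s0 : 0 <= rho + al + nF f1 by rewrite !addr_ge0.
  have h1 := ler_wpM2r s0 U1; have h2 := ler_wpM2l U_ge0 F2;
    have h3 := ler_wpM2l U_ge0 h1.
  have h4 := ler_wpM2l U_ge0 F1; have h5 := mulr_ge0 U_ge0 s0.
  lra.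
- by apply: le_trans cE _; have := ler_wpM2l U_ge0 Cn; rewrite -/a; lra.
- rewrite -/a; have om0 := omega_ge0; set om := kappa * U in om0 *.
  have F5 : nF f5 <= 20 * (om * (al + a)).
    by apply: le_trans dyE _; rewrite mulrCA ler_wpM2l.
  have Al' : nF (A *m l') <= 20 * (nF f5 + nF f6).
    apply: le_trans (T_ge _) _; rewrite Tl' ler_wpM2l//; exact: normFD.
  have F6 : nF f6 <= om * (al + a + 20 * (nF f5 + nF f6)).
    apply: le_trans wE _; have -> : om = U * kappa by rewrite /om mulrC.
    rewrite -mulrA ler_wpM2l//; apply: le_trans (A_ge _) _; rewrite ler_wpM2l//.
    rewrite wk (mulmxDr A (e + k) l') (mulmxDr A e k);
      have := normFD (A *m e + A *m k) (A *m l').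
    by have := normFD (A *m e) (A *m k); rewrite Ae -/a; lra.
  have F7 : nF f7 <= U * nF x + om * (a + 20 * (nF f5 + nF f6)).
    apply: le_trans x'E _; have -> : om = U * kappa by rewrite /om mulrC.
    rewrite -mulrA -mulrDr ler_wpM2l//.
    have -> : xh + w = x + (k + l') by rewrite wk /e; apply/matrixP => i j;
      rewrite !mxE; ring.
    apply: le_trans (normFD _ _) _; rewrite lerD2l.
    apply: le_trans (A_ge _) _; rewrite ler_wpM2l// (mulmxDr A k l').
    by have := normFD (A *m k) (A *m l'); rewrite -/a; lra.
  have h1 : om * (nF f5 + nF f6) <= 1 / 10 ^+ 6 * (nF f5 + nF f6).
    by rewrite ler_wpM2r// addr_ge0.
  have h2 : 0 <= om * al by rewrite mulr_ge0.
  have h3 : 0 <= om * a by rewrite mulr_ge0.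
  rewrite (mulmxDr A l' f7); have := normFD (A *m l') (A *m f7);
    have := A_le f7.
  have := normF_ge0 f5; have := normF_ge0 f6.
  lra.
Qed.

(** The terms proportional to [|A k|] in the bound of [p3] and [l] carry a
    factor [kappa U] and are absorbed. *)
Lemma refine_contraction xh x' : refine_errors kappa U A T b xh x' ->
  nF (A *m (x - x')) <= 1000 * (U * nF x + kappa * U * nF (b - A *m x)
    + kappa * U * nF (A *m (x - xh))).
Proof.
move=> /refine_error_split /= [k [l [p2 [p3 [p1 [xE kE [P1 P2] P3 Al]]]]]].
set al := nF (A *m (x - xh)) in P1 P2 P3 Al *;
  set rho := nF (b - A *m x) in P2 *.
have al0 : 0 <= al by exact: normF_ge0.
have rho0 : 0 <= rho by exact: normF_ge0.
set a := nF (A *m k) in P3 Al; have a0 : 0 <= a by exact: normF_ge0.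
have aE : a <= nF p1 + kappa * (nF p2 + nF p3).
  apply: le_trans (normal_solve_bound (p := p1) (q := p2 + p3) _) _.
    by rewrite addrA.
  by rewrite lerD2l ler_wpM2l// normFD.
have -> : x - x' = - (k + l) by rewrite -xE opprB.
rewrite mulmxN normFN mulmxDr; have := normFD (A *m k) (A *m l); rewrite -/a.
have := ler_wpM2l kappa_ge0 P2; have := ler_wpM2l kappa_ge0 P3.
set X := nF x in P1 P2 Al *; have X0 : 0 <= X by exact: normF_ge0.
have om1 := kappaU_small.
have om0 := omega_ge0; have Uom := U_le_omega;
  set om := kappa * U in om1 om0 Uom Al *.
have -> : kappa * (20 * U * (al + a)) = 20 * (om * al + om * a) by rewrite /om;
  ring.
have -> : kappa * (3 * U * (rho + (al + U * (X + kappa * al)))) =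
    3 * (om * rho + om * al + om * (U * X) + om * (om * al)) by rewrite /om;
      ring.
have P1' : nF p1 <= U * X + om * al by apply: le_trans P1 _; rewrite /om; lra.
have h1 : om * a <= 1 / 10 ^+ 6 * a by rewrite ler_wpM2r.
have h2 : om * (om * al) <= 1 / 10 ^+ 6 * (om * al) by rewrite ler_wpM2r//
  mulr_ge0.
have h3 : om * (U * X) <= 1 / 10 ^+ 6 * (U * X) by rewrite ler_wpM2r// mulr_ge0.
have h4 : 0 <= om * al by rewrite mulr_ge0.
have h5 : 0 <= om * rho by rewrite mulr_ge0.
have h6 : 0 <= U * X by rewrite mulr_ge0.
have h7 : om * (al + a) = om * al + om * a by ring.
rewrite h7 in Al.
lra.
Qed.

(** The part [s] of [p2] that is of order [U rho] is routed through the normal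
    equations: [k2] is the response to it, and [A^T (b - A x' - A h) = - s].
    Everything else goes to [h]. Its contributions of size
    [kappa U |A (x - xh)|], [kappa U (|x| + kappa rho) U] and [U |x|] are of
    order [U K |x'|] by the last three hypotheses. *)
Lemma refine_backward_error xh x' K : refine_errors kappa U A T b xh x' ->
  x' != 0 -> 1 <= K -> kappa * U * K <= 1 / 10 ^+ 8 ->
  (forall z : 'cV_n, nF (b - A *m x) <= nF (b - A *m z)) ->
  nF x <= K * nF x' ->
  kappa * (U * nF x + kappa * U * nF (b - A *m x)) <= K * nF x' ->
  kappa * nF (A *m (x - xh)) <= 6 * 10 ^+ 4 * (K * nF x') ->
  backward_error A b x' <= 10 ^+ 9 * (U * K).
Proof.
move=> /refine_error_split /= [k [l [p2 [p3 [p1 [xE kE [P1 P2] P3 Al]]]]]].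
move=> x'0 K1 omK xmin; set al := nF (A *m (x - xh)) in P1 P2 P3 Al *.
set rho := nF (b - A *m x) in P2 xmin *; set X := nF x in P1 P2 Al *.
have al0 : 0 <= al by exact: normF_ge0.
have rho0 : 0 <= rho by exact: normF_ge0.
have X0 : 0 <= X by exact: normF_ge0.
set a := nF (A *m k) in P3 Al; have a0 : 0 <= a by exact: normF_ge0.
have N0 : 0 < nF x' by exact: normF_gt0.
set Y := K * nF x'; have Y0 : 0 <= Y by rewrite mulr_ge0// (le_trans _ K1).
move=> XY; have om1 := kappaU_small.
have om0 := omega_ge0; have Uom := U_le_omega.
set om := kappa * U in om1 om0 Uom Al omK *; move=> resY alY.
have omY : om * Y <= 1 / 10 ^+ 6 * Y by rewrite ler_wpM2r.
have kUX : 0 <= kappa * (U * X) by rewrite !mulr_ge0.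
have koR : 0 <= kappa * (om * rho) by rewrite !mulr_ge0.
have kal0 : 0 <= kappa * al by rewrite mulr_ge0.
set F := U * (X + kappa * al) in P1 P2;
  have F0 : 0 <= F by rewrite mulr_ge0// addr_ge0.
have FY : F <= 7 * 10 ^+ 4 * (U * Y).
  rewrite /F (_ : 7 * 10 ^+ 4 * (U * Y) = U * (7 * 10 ^+ 4 * Y)); last by ring.
  by rewrite ler_wpM2l//; lra.
have kFY : kappa * F <= Y.
  have := ler_wpM2l kappa_ge0 FY.
  rewrite (_ : kappa * (7 * 10 ^+ 4 * (U * Y)) = 7 * 10 ^+ 4 * (om * Y));
    last by rewrite /om; ring.
  lra.
have kF0 : 0 <= kappa * F by rewrite mulr_ge0.
have kaY : kappa * a <= 20 * Y.
  have aE : a <= nF p1 + kappa * (nF p2 + nF p3).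
    apply: le_trans (normal_solve_bound (p := p1) (q := p2 + p3) _) _.
      by rewrite addrA.
    by rewrite lerD2l ler_wpM2l// normFD.
  have h1 := ler_wpM2l kappa_ge0 aE; have h2 := ler_wpM2l kappa_ge0 P1.
  have h3 := ler_wpM2l kappa_ge0 (ler_wpM2l kappa_ge0 P2).
  have h4 := ler_wpM2l kappa_ge0 (ler_wpM2l kappa_ge0 P3).
  move: h3 h4.
  have -> : kappa * (kappa * (20 * U * (al + a))) = 20 * (om * (kappa * al) +
    om * (kappa * a)).
    by rewrite /om; ring.
  have -> : kappa * (kappa * (3 * U * (rho + (al + F)))) =
    3 * (kappa * (om * rho) + om * (kappa * al) +
      om * (kappa * F)) by rewrite /om; ring.
  have ka0 : 0 <= kappa * a by rewrite mulr_ge0.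
  have h5 : om * (kappa * al) <=
    1 / 10 ^+ 6 * (kappa * al) by rewrite ler_wpM2r.
  have h6 : om * (kappa * a) <= 1 / 10 ^+ 6 * (kappa * a) by rewrite ler_wpM2r.
  have h7 : om * (kappa * F) <= 1 / 10 ^+ 6 * (kappa * F) by rewrite ler_wpM2r.
  lra.
have UY0 : 0 <= U * Y by rewrite mulr_ge0.
have UkalY : U * (kappa * al) <= 6 * 10 ^+ 4 * (U * Y).
  by have := ler_wpM2l U_ge0 alY; lra.
have UkaY : U * (kappa * a) <= 20 * (U * Y).
  by have := ler_wpM2l U_ge0 kaY; lra.
have UkFY : U * (kappa * F) <= U * Y by rewrite ler_wpM2l.
have UXY : U * X <= U * Y by rewrite ler_wpM2l.
have [s [t [p2E sE tE]]] : exists s t, [/\ p2 = s + t, nF s <= 3 * U * rho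
    & nF t <= 3 * U * (al + F)].
  by apply: normF_split; rewrite -?mulrDr// !mulr_ge0// addr_ge0.
pose k2 := invmx (A^T *m A) *m s; pose k1 := k - k2.
have k2E : A^T *m A *m k2 = s by rewrite mulmxA mulmxV// mul1mx.
have k1E : A^T *m A *m k1 = A^T *m p1 + (t + p3).
  rewrite mulmxBr k2E kE p2E.
  by apply/matrixP => i j; rewrite !mxE; ring.
have Ak1 : nF (A *m k1) <= 2 * 10 ^+ 6 * (U * Y).
  have := normal_solve_bound k1E.
  have := ler_wpM2l kappa_ge0 (normFD t p3).
  have := ler_wpM2l kappa_ge0 P3; have := ler_wpM2l kappa_ge0 tE; lra.
have Al' : nF (A *m l) <= 32 * 10 ^+ 6 * (U * Y).
  move: Al; have -> : om * (al + a) = U * (kappa * al) +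
    U * (kappa * a) by rewrite /om; ring.
  lra.
pose h := - (k1 + l).
have Ah : nF (A *m h) <= 4 * 10 ^+ 7 * (U * Y).
  rewrite mulmxN normFN mulmxDr; have := normFD (A *m k1) (A *m l); lra.
have eE : 4 * 10 ^+ 7 * (U * Y) = 4 * 10 ^+ 7 * (U * K) * nF x' by rewrite /Y;
  ring.
have UK : U <= U * K by rewrite ler_peMr.
have := @backward_error_bound R m n A b x' h (4 * 10 ^+ 7 * (U * K)) x'0.
have -> : 9 * (4 * 10 ^+ 7 * (U * K)) = 36 * 10 ^+ 7 * (U * K) by ring.
have UK0 : 0 <= U * K by apply: le_trans UK.
have hH : nF h <= nF x'.
  apply: le_trans (A_ge _) _.
  have := ler_wpM2l kappa_ge0 Ah; rewrite eE.
  have := ler_wpM2r (ltW N0) omK; rewrite /om; lra.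
move=> H; apply: le_trans (H _ hH _) _; [by rewrite -eE| |by lra].
have -> : A^T *m (b - A *m x' - A *m h) = - s.
  have -> : b - A *m x' - A *m h = (b - A *m x) - A *m k2.
    have -> : x' = x + (k + l) by rewrite -xE addrC subrK.
    rewrite /h /k1 -!addrA -!opprD -!mulmxDr; congr (b - A *m _).
    by apply/matrixP => i j; rewrite !mxE; ring.
  by rewrite mulmxBr x_normal sub0r mulmxA k2E.
rewrite normFN; apply: le_trans sE _.
have := ler_wpM2l UK0 (xmin x'); have := ler_wpM2r rho0 UK;
  have := mulr_ge0 UK0 rho0.
lra.
Qed.

Lemma unit_rhs_le : nF b = 1 -> 1 <= nF x + nF (b - A *m x).
Proof.
move=> b1; rewrite -b1 -{1}[b](subrK (A *m x)) addrC.
by apply: le_trans (normFD _ _) _; rewrite lerD2r.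
Qed.

(** [T (x0 - x)] is the image under [Q^T] of [S (b - A x)], whose norm is of
    order [rho] because the sketch does not magnify the optimal residual, up
    to rounding errors. *)
Lemma sketch_and_solve_error d (S : 'M[R]_(d, m)) (Q : 'M[R]_(d, n))
    (z x0 : 'cV[R]_n) :
  Q^T *m Q = 1%:M ->
  (forall v : 'cV_n, nF (S *m (A *m v) - Q *m (T *m v)) <= U * nF v) ->
  nF (S *m (b - A *m x)) <= 2 * nF (b - A *m x) ->
  nF b = 1 ->
  nF (z - Q^T *m (S *m b)) <= U -> nF (T *m x0 - z) <= U * nF x0 ->
  nF (A *m (x - x0)) <= 50 * nF (b - A *m x) + 100 * (U * nF x).
Proof.
move=> QQ SQT Sr nb zE x0E; have b1 := unit_rhs_le nb;
  rewrite -normFN -mulmxN opprB.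
set rho := nF (b - _) in Sr b1 *; set X := nF x in b1 *.
set al := nF _; have al0 : 0 <= al by exact: normF_ge0.
have rho0 : 0 <= rho by exact: normF_ge0.
have TE : T *m (x0 - x) = (T *m x0 - z) + (z - Q^T *m (S *m b))
    + (Q^T *m (S *m (b - A *m x)) + Q^T *m (S *m (A *m x) - Q *m (T *m x))).
  have QTx : Q^T *m (Q *m (T *m x)) = T *m x by rewrite mulmxA QQ mul1mx.
  rewrite (mulmxBr Q^T (S *m (A *m x)) (Q *m (T *m x))) QTx (mulmxBr T x0 x).
  rewrite (mulmxBr S b (A *m x)) (mulmxBr Q^T (S *m b) (S *m (A *m x))).
  by apply/matrixP => i j; rewrite !mxE; ring.
have x0_le : nF x0 <= X + kappa * al.
  rewrite -[x0](subrK x) addrC; apply: le_trans (normFD _ _) _.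
  by rewrite lerD2l A_ge.
have h1 : nF (T *m (x0 - x)) <= U * (X + kappa * al) + U + (2 * rho + U * X).
  rewrite TE; apply: le_trans (normFD _ _) _; apply: lerD.
    apply: le_trans (normFD _ _) _; apply: lerD => //.
    by apply: le_trans x0E _; rewrite ler_wpM2l.
  apply: le_trans (normFD _ _) _; apply: lerD.
    by apply: le_trans Sr; exact: normF_orthT.
  by apply: le_trans (SQT x); exact: normF_orthT.
have := T_ge (x0 - x); rewrite -/al.
have X0 : 0 <= X by exact: normF_ge0.
have U1 : U * 1 <= U * X + U * rho by rewrite -mulrDr ler_wpM2l.
have Us : U <= 1 / 10 ^+ 6 by apply: le_trans kappaU_small.
have h2 : U * rho <= 1 / 10 ^+ 6 * rho by rewrite ler_wpM2r.
have h3 : kappa * U * al <= 1 / 10 ^+ 6 * al by rewrite ler_wpM2r.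
have h4 : 0 <= U * X by rewrite mulr_ge0.
lra.
Qed.

(** The two steps are treated differently: the first only has to contract the
    error of the initial iterate, and the resulting bound is what makes the
    error terms of the second one quadratic in [U]. *)
Lemma refined_iterates (L P u : R) x0 x1 x2 :
  nF b = 1 ->
  nF (A *m (x - x0)) <= 50 * nF (b - A *m x) + 100 * (U * nF x) ->
  refine_errors kappa U A T b x0 x1 -> refine_errors kappa U A T b x1 x2 ->
  U = P * u -> 0 < u -> 1000 <= P -> 1 <= L ->
  kappa * U * (P * L) <= 1 / 10 ^+ 8 ->
  nF x + kappa * (nF x + kappa * nF (b - A *m x)) * u <= L * nF x2 ->
  nF (A *m (x - x1)) <= 6 * 10 ^+ 4 * U * (nF x + kappa * nF (b - A *m x)) /\
  backward_error A b x2 <= 10 ^+ 9 * (U * (P * L)).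
Proof.
move=> b1 al0 ref1 ref2 UE u_gt0 P1000 L1 omK Bx.
have := unit_rhs_le b1; have := refine_contraction ref1.
set rho := nF (b - A *m x) in al0 Bx *; set X := nF x in al0 Bx * => al1 Xrho.
have rho0 : 0 <= rho by exact: normF_ge0.
have X0 : 0 <= X by exact: normF_ge0.
have al1' : nF (A *m (x - x1)) <= 6 * 10 ^+ 4 * (U * X + kappa * U * rho).
  have := ler_wpM2l omega_ge0 al0.
  have UX0 : 0 <= U * X by rewrite mulr_ge0.
  have : kappa * U * (U * X) <= 1 / 10 ^+ 6 * (U * X) by rewrite ler_wpM2r.
  have := mulr_ge0 omega_ge0 rho0; lra.
have P0 : 0 <= P by apply: le_trans P1000.
have L0 : 0 <= L by apply: le_trans L1.
have u0 := ltW u_gt0.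
have kB0 : 0 <= kappa * (X + kappa * rho) * u.
  by rewrite !mulr_ge0// addr_ge0// mulr_ge0.
have XL : X <= L * nF x2 by apply: le_trans Bx; rewrite lerDl.
have BL : kappa * (X + kappa * rho) * u <= L * nF x2 by apply: le_trans Bx;
  rewrite lerDr.
have x20 : x2 != 0.
  apply/eqP => x2z; move: XL BL; rewrite x2z normF0 mulr0 => XL.
  have x00 : X = 0 by apply/eqP; rewrite eq_le XL.
  rewrite x00 add0r in Xrho; rewrite x00 add0r leNgt => /negP; apply.
  have rp : 0 < rho by exact: lt_le_trans Xrho.
  have kp : 0 < kappa by exact: lt_le_trans kappa_ge1.
  by rewrite !mulr_gt0.
split.
  by rewrite (_ : 6 * 10 ^+ 4 * U * _ = 6 * 10 ^+ 4 * (U * X +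
    kappa * U * rho))//; ring.
have kal : kappa * (U * X + kappa * U * rho) <= P * L * nF x2.
  have -> : kappa * (U * X + kappa * U * rho) = P * (kappa * (X +
    kappa * rho) * u).
    by rewrite UE; ring.
  by rewrite -(mulrA P L) ler_wpM2l.
have P1 : 1 <= P by apply: le_trans P1000; rewrite ler1n.
apply: (refine_backward_error ref2 x20 _ omK _ _ kal _).
- by rewrite -[1]mulr1 ler_pM.
- by move=> v; have := normal_equations_argmin x_normal v; rewrite !euclideanE.
- by rewrite -(mulrA P L); apply: le_trans XL _; rewrite ler_peMl// mulr_ge0.
- have := ler_wpM2l kappa_ge0 al1'; lra.
Qed.

End Refinement.

(** * The computed iterates *)

Section Assembly.
Context {R : realType}.

Lemma upper_unit_diag n (T : 'M[R]_n) :
  (forall i j : 'I_n, (j < i)%N -> T i j = 0) -> T \in unitmx ->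
  forall i, T i i != 0.
Proof.
move=> Tu; rewrite unitmxE -det_tr det_trig; last first.
  by apply/is_trig_mxP => i j ij; rewrite mxE Tu.
rewrite unitfE => /prodf_neq0 H i.
by have := H i isT; rewrite mxE.
Qed.

Lemma fl_solve_err (u e : R) n (T : 'M[R]_n) z x : 0 <= u ->
  (forall i j : 'I_n, (j < i)%N -> T i j = 0) -> (forall i, T i i != 0) ->
  u <= e -> gam u n.+2 <= e -> e <= 1 / 2 ->
  fl_solve u T z x -> nF (T *m x - z) <= 6 * e * (nF T * nF x).
Proof.
move=> u0 Tu T0 ue ge e2; apply: fl_subst_err => //.
- by move=> i /=; rewrite ltnn.
- by move=> i j ij /=; rewrite -leqNgt leq_eqVlt eq_sym val_eqE (negPf ij) /=;
    exact: Tu.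
Qed.

Lemma fl_solveT_err (u e : R) n (T : 'M[R]_n) z x : 0 <= u ->
  (forall i j : 'I_n, (j < i)%N -> T i j = 0) -> (forall i, T i i != 0) ->
  u <= e -> gam u n.+2 <= e -> e <= 1 / 2 ->
  fl_solveT u T z x -> nF (T^T *m x - z) <= 6 * e * (nF T * nF x).
Proof.
move=> u0 Tu T0 ue ge e2; rewrite -(normFT T); apply: fl_subst_err => //.
- by move=> i /=; rewrite ltnn.
- move=> i j ij /=; rewrite -leqNgt leq_eqVlt val_eqE (negPf ij) /= mxE;
    exact: Tu.
- by move=> i; rewrite mxE.
Qed.

Lemma fl_refine_errors (u e kappa U : R) m n (A : 'M[R]_(m, n)) b
    (solver : inner_solver n) (T : 'M[R]_n) xh x' :
  0 <= u -> u <= e -> gam u n.+2 <= e -> gam u m.+1 <= e -> e <= 1 / 2 ->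
  (forall i j : 'I_n, (j < i)%N -> T i j = 0) -> (forall i, T i i != 0) ->
  nF A <= n%:R -> nF T <= 2 * n%:R -> 12 * (e * n%:R) <= U -> u <= U ->
  (forall c dy : 'cV[R]_n, solver (fl_operator u A T) c dy ->
     nF (dy - invmx (preconditioned A T) *m c) <= kappa * U * nF c) ->
  fl_refine u A b solver T xh x' -> refine_errors kappa U A T b xh x'.
Proof.
move=> u0 ue gn gm e2 Tu T0 An Tn eU uU sE.
case=> y [r [g [c [dy [w [[yE rE] [gE cE] dyE wE x'E]]]]]].
have e0 := le_trans u0 ue; have en : 0 <= e * n%:R by rewrite mulr_ge0.
have U0 := le_trans u0 uU.
have mulE p q (B : 'M[R]_(p, q)) (v : 'cV_q) (C : 'cV_p) :
    gam u q.+1 <= e -> nF B <= n%:R ->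
    fl_mulmx u B v C -> nF (C - B *m v) <= U * nF v.
  move=> gq Bn /(fl_mulmx_err u0) H; apply: le_trans H _; rewrite mulrA.
  rewrite ler_wpM2r//; apply: le_trans eU.
  have := ler_wpM2r (normF_ge0 B) gq; have := ler_wpM2l e0 Bn; lra.
have solE (v : 'cV[R]_n) : 6 * e * (nF T * nF v) <= U * nF v.
  rewrite mulrA ler_wpM2r//; apply: le_trans eU.
  by have := ler_wpM2l e0 Tn; lra.
exists y, r, g, c, dy, w; split.
- split; first by apply: mulE yE => //; apply: le_trans gn; exact: ler_gam.
  by apply: le_trans (fl_submx_err u0 rE) _; rewrite ler_wpM2r.
- split; first by apply: mulE gE => //; rewrite normFT.
  by apply: le_trans (solE c); apply: fl_solveT_err cE.
- exact: sE dyE.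
- by apply: le_trans (solE w); apply: fl_solve_err wE.
- by apply: le_trans (fl_addmx_err u0 x'E) _; rewrite ler_wpM2r.
Qed.

Lemma condE m n (A : 'M[R]_(m, n)) : cond A = spectral_norm A / sigma_min A.
Proof. by []. Qed.

(** The second bound holds because a nonzero vector exists: a matrix without
    columns has spectral norm 0. *)
Lemma cond_bounds m n (A : 'M[R]_(m, n)) : spectral_norm A = 1 ->
  0 < sigma_min A ->
  (forall v : 'cV_n, nF v <= cond A * nF (A *m v)) /\ 1 <= cond A.
Proof.
move=> A1 s0.
have Age (v : 'cV_n) : nF v <= cond A * nF (A *m v).
  rewrite condE A1 mul1r ler_pdivlMl//; exact: sigma_min_bound.
split=> //; case: n => [|n] in A A1 s0 Age *.
  by have := spectral_norm_le_normF A; rewrite A1 (thinmx0 A) normF0 ler10.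
have v0 : 0 < nF (const_mx 1 : 'cV[R]_n.+1).
  apply: normF_gt0; apply/eqP => /matrixP/(_ 0 0); rewrite !mxE => /eqP.
  by rewrite oner_eq0.
rewrite -(ler_pM2r v0) mul1r; apply: le_trans (Age _) _.
have := spectral_norm_bound A (const_mx 1); rewrite A1 mul1r => H.
apply: ler_wpM2l H; rewrite condE A1 divr_ge0// ltW//.
Qed.

Lemma sketching_row m n d (S : 'M[R]_(d, m)) (A : 'M[R]_(m, n))
    (b : 'cV[R]_m) eta (y : 'cV[R]_n) t :
  eta <= 9 / 10 -> sketching S (row_mx A b) eta ->
  nF (S *m (A *m y + t *: b)) <= 19 / 10 * nF (A *m y + t *: b).
Proof.
move=> e9 [_ _ /(_ (col_mx y t%:M))[_]].
rewrite mul_row_col mul_mx_scalar !euclideanE => H; apply: le_trans H _.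
by rewrite ler_wpM2r//; lra.
Qed.

(** The properties of the computed factor on which the refinement rests: it is
    an invertible triangular matrix which preconditions [A] well. *)
Lemma sketched_qr (u e E kappa eta : R) m n d (A : 'M[R]_(m, n)) (S :
  'M[R]_(d, m))
    (SAh Qh : 'M[R]_(d, n)) (T : 'M[R]_n) :
  0 <= u -> u <= e -> gam u d.+1 <= e -> 280 * (e * n%:R) <= 1 ->
    e <= 1 / 1000 ->
  (forall v : 'cV_n, nF (A *m v) <= nF v) ->
  (forall v : 'cV_n, nF v <= kappa * nF (A *m v)) ->
  0 <= E -> kappa * (280 * (e * n%:R * n%:R) + E) <= 1 / 20 -> E <= 1 / 10 ->
  sketching S A eta -> eta <= 9 / 10 ->
  (forall v : 'cV_n, nF ((SAh - S *m A) *m v) <= E * nF v) ->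
  fl_qr u SAh Qh T ->
  exists Q : 'M[R]_(d, n),
    [/\ Q^T *m Q = 1%:M,
        nF (Qh - Q) <= 140 * (e * n%:R * n%:R),
        forall v : 'cV_n, nF (S *m (A *m v) - Q *m (T *m v)) <=
          (280 * (e * n%:R * n%:R) + E) * nF v,
        (forall v : 'cV_n, nF (T *m v) <= 2 * nF (A *m v)) /\
        (forall v : 'cV_n, nF (A *m v) <= 20 * nF (T *m v))
      & (forall i j : 'I_n, (j < i)%N -> T i j = 0) /\ (forall i, T i i != 0)].
Proof.
move=> u0 ue gd en e3 Ale Age E0 kE E1 [_ _ SA] eta9 SAhE /(fl_qr_err u0 ue gd
  e3).
case=> Q [QQ SAhQ QhQ Tu]; have e0 := le_trans u0 ue.
have g : gam (70 * e) n <= 140 * (e * n%:R).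
  have := @gam_le R (70 * e) _ n; rewrite mulr_ge0// => /(_ isT).
  rewrite (_ : 2 * n%:R * (70 * e) = 140 * (e * n%:R)); last by ring.
  by apply; have := mulr_ge0 e0 (ler0n R n); lra.
have SAh2 : nF SAh <= 2 * n%:R.
  apply: normF_le_op => // v; rewrite -[SAh](subrK (S *m A)) mulmxDl -mulmxA.
  apply: le_trans (normFD _ _) _.
  have := SAhE v; have [_] := SA v; rewrite !euclideanE.
  have := ler_wpM2r (normF_ge0 v) E1; have := Ale v.
  have := normF_ge0 (A *m v).
  have h : (1 + eta) * nF (A *m v) <=
    19 / 10 * nF (A *m v) by rewrite ler_wpM2r//; lra.
  lra.
have SQT (v : 'cV_n) : nF (S *m (A *m v) - Q *m (T *m v)) <=
    (280 * (e * n%:R * n%:R) + E) * nF v.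
  have -> : S *m (A *m v) - Q *m (T *m v) = (SAh - Q *m T) *m v - (SAh - S *m A)
    *m v.
    rewrite !mulmxBl -!mulmxA; apply/matrixP => i j; rewrite !mxE; ring.
  apply: le_trans (normFB _ _) _; rewrite mulrDl; apply: lerD => //.
  apply: le_trans (normFM _ _) _; rewrite ler_wpM2r//.
  apply: le_trans SAhQ _; apply: le_trans (ler_wpM2r (normF_ge0 _) g) _.
  have := ler_wpM2l (mulr_ge0 e0 (ler0n R n)) SAh2; lra.
have F0 : 0 <= 280 * (e * n%:R * n%:R) + E by rewrite addr_ge0// !mulr_ge0.
have SQT' (v : 'cV_n) : nF (S *m (A *m v) - Q *m (T *m v)) <=
  1 / 20 * nF (A *m v).
  apply: le_trans (SQT v) _; have := ler_wpM2l F0 (Age v).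
  have := ler_wpM2r (normF_ge0 (A *m v)) kE; lra.
have Tle (v : 'cV_n) : nF (T *m v) <= 2 * nF (A *m v).
  have := normFB (S *m (A *m v)) (S *m (A *m v) - Q *m (T *m v)).
  rewrite opprB addrC subrK (normF_orth _ QQ); have := SQT' v.
  have [_] := SA v; rewrite !euclideanE.
  have h : (1 + eta) * nF (A *m v) <=
    19 / 10 * nF (A *m v) by rewrite ler_wpM2r//; lra.
  have := normF_ge0 (A *m v); lra.
have Tge (v : 'cV_n) : nF (A *m v) <= 20 * nF (T *m v).
  have := normFD (S *m (A *m v) - Q *m (T *m v)) (Q *m (T *m v)).
  rewrite subrK (normF_orth _ QQ); have := SQT' v.
  have [+ _] := SA v; rewrite !euclideanE.
  have h : 1 / 10 * nF (A *m v) <=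
    (1 - eta) * nF (A *m v) by rewrite ler_wpM2r//; lra.
  have := normF_ge0 (A *m v); lra.
exists Q; split=> //.
- apply: le_trans QhQ _; have := ler_wpM2l (ler0n R n) g; lra.
- split=> //; apply: upper_unit_diag => //; apply: injective_unitmx => v Tv.
  apply: normF0_eq0; apply: le_anti; rewrite normF_ge0 andbT.
  have := Tge v; rewrite Tv normF0 mulr0 => Av.
  have Av0 : nF (A *m v) = 0 by apply/eqP; rewrite eq_le Av /=.
  by have := Age v; rewrite Av0 mulr0.
Qed.

Lemma dims_le_cube (m n d : nat) : (n <= m)%N -> (d <= n ^ 3)%N ->
  (m.+2 <= (m + 4) ^ 3)%N /\ (d.+2 <= (m + 4) ^ 3)%N.
Proof.
move=> nm dn; have nm3 : (n ^ 3 <= m ^ 3)%N by rewrite leq_exp2r.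
have -> : ((m + 4) ^ 3 = m ^ 3 + (12 * m ^ 2 + 48 * m + 64))%N by ring.
move: (leq_trans dn nm3); set p := (m ^ 3)%N; set r := (m ^ 2)%N.
by move: p r => p r {nm3 dn}; lia.
Qed.

(** The choice of the polynomial [P]. Here [q = m + 4] and [r = n]; all
    the sums to be computed have fewer than [q^3] terms, because the sketch has
    at most [n^3] rows, and [gam] is then at most [e = 2 q^3 u]. The Frobenius
    norms of [A] and [T] and the [n] steps of the QR factorization cost two
    further factors [n], and [L] majorizes the given prefactors. *)
Lemma rounding_budget (L q r kappa u e P U : R) :
  4 <= q -> 0 <= r -> r <= q -> 1 <= L -> 0 <= u -> 1 <= kappa ->
    e = 2 * q ^+ 3 * u ->
  P = 1000 * q ^+ 5 * L -> U = P * u ->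
  10 ^+ 8 * (P ^+ 2 * L) * (kappa * u) <= 1 ->
  [/\ 1000 <= P, kappa * U * (P * L) <= 1 / 10 ^+ 8, kappa * U <= 1 / 10 ^+ 6,
      u <= e /\ u <= U
    & [/\ e <= 1 / 1000, 280 * (e * r) <= 1, 12 * (e * r) <= U
        & [/\ 4 * (e * r) + 280 * (e * r * r) + L * u <= U,
              280 * (e * r * r) + L * u <= U,
              kappa * (280 * (e * r * r) + L * u) <= 1 / 20,
              L * u <= U & L * u <= 1 / 10]]].
Proof.
move=> q4 r0 rq L1 u0 k1 eE PE UE small.
have q1 : 1 <= q by lra. have q0 : 0 <= q by lra.
have qX k : 1 <= q ^+ k by rewrite exprn_ege1.
have qL := ler_pM ler01 ler01 (qX 5%N) L1; rewrite mul1r in qL.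
have P1000 : 1000 <= P by rewrite PE -mulrA; lra.
have P0 : 0 <= P by lra. have L0 : 0 <= L by lra. have k0 : 0 <= kappa by lra.
have U0 : 0 <= U by rewrite UE mulr_ge0.
have PL1 : 1 <= P * L.
  by have := ler_pM ler01 ler01 (le_trans _ P1000) L1; rewrite mul1r; apply;
    lra.
have omK : kappa * U * (P * L) <= 1 / 10 ^+ 8.
  by rewrite (_ : kappa * U * _ = P ^+ 2 * L * (kappa * u)) ?UE; [lra|ring].
have om : kappa * U <= 1 / 10 ^+ 6.
  have : kappa * U <= kappa * U * (P * L) by rewrite ler_peMr// mulr_ge0.
  lra.
have e0 : 0 <= e by rewrite eE !mulr_ge0// exprn_ge0.
have ue : u <= e by rewrite eE ler_peMl//; have := qX 3%N; lra.
have eq0 : e <= e * q by rewrite ler_peMr.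
have eqq : e * q <= e * q * q by rewrite ler_peMr// mulr_ge0.
have er : e * r <= e * q by rewrite ler_wpM2l.
have er0 : 0 <= e * r by rewrite mulr_ge0.
have err0 : 0 <= e * r * r by rewrite mulr_ge0.
have err : e * r * r <= e * q * q by rewrite ler_pM// mulr_ge0.
have Lu0 : 0 <= L * u by rewrite mulr_ge0.
have uU : u <= U by rewrite UE ler_peMl//; lra.
have Us : U <= 1 / 10 ^+ 6 by apply: le_trans om; rewrite ler_peMl.
have eU : 300 * (e * q * q) + L * u <= U.
  have h1 : q ^+ 5 * u <= q ^+ 5 * L * u.
    by rewrite ler_wpM2r// ler_peMr// exprn_ge0.
  have h2 : L * u <= q ^+ 5 * L * u by rewrite ler_wpM2r// ler_peMl.
  rewrite UE PE eE (_ : 2 * q ^+ 3 * u * q * q = 2 * (q ^+ 5 * u));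
    last by ring.
  have h3 : 0 <= q ^+ 5 * u by rewrite mulr_ge0// exprn_ge0.
  lra.
have om' : kappa * U <= 1 / 20 by lra.
split=> //; move=> {small omK qL qX PL1 P1000 P0 PE eE UE q4 L1 k1 U0 L0 om P}.
have eru : 280 * (e * r * r) + L * u <= U by lra.
have keru := ler_wpM2l k0 eru.
by split; [lra|lra|lra|split=> //; lra].
Qed.

Lemma sketched_rhs (u e f : R) m n d (S : 'M[R]_(d, m)) (b : 'cV[R]_m) Sbh
    (Qh Q : 'M[R]_(d, n)) z :
  0 <= u -> gam u d.+1 <= e -> 0 <= f -> f <= 1 / 10 -> 140 * (e * n%:R) <= 1 ->
  Q^T *m Q = 1%:M -> nF (Qh - Q) <= 140 * (e * n%:R * n%:R) ->
  nF (S *m b) <= 19 / 10 -> nF (Sbh - S *m b) <= f ->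
  fl_mulmx u Qh^T Sbh z ->
  nF (z - Q^T *m (S *m b)) <= 4 * (e * n%:R) + 280 * (e * n%:R * n%:R) + f.
Proof.
move=> u0 gd f0 f1 en QQ QhQ Sb SbhE zE.
have e0 : 0 <= e by apply: le_trans gd; exact: gam_ge0.
have Sbh2 : nF Sbh <= 2.
  by have := normFD (Sbh - S *m b) (S *m b); rewrite subrK; lra.
have Qhn : nF Qh <= 2 * n%:R.
  have := normFD (Qh - Q) Q; rewrite subrK.
  have : nF Q <= n%:R by rewrite -[Q]mulmx1 normF_orth// normF1.
  have := ler_wpM2r (ler0n R n) en; lra.
have h1 := fl_mulmx_err u0 zE; rewrite normFT in h1.
have h2 : gam u d.+1 * (nF Qh * nF Sbh) <= e * (2 * n%:R * 2).
  apply: ler_pM => //; [exact: gam_ge0|by rewrite mulr_ge0|exact: ler_pM].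
have h3 : nF ((Qh - Q)^T *m Sbh) <= 140 * (e * n%:R * n%:R) * 2.
  by apply: le_trans (normFM _ _) _; rewrite normFT ler_pM.
have h4 : nF (Q^T *m (Sbh - S *m b)) <= f.
  by apply: le_trans SbhE; exact: normF_orthT.
have -> : z - Q^T *m (S *m b) = (z - Qh^T *m Sbh)
    + ((Qh - Q)^T *m Sbh + Q^T *m (Sbh - S *m b)).
  have -> : (Qh - Q)^T = Qh^T - Q^T by rewrite linearB.
  by rewrite mulmxBl (mulmxBr Q^T); apply/matrixP => i j; rewrite !mxE; ring.
apply: le_trans (normFD _ _) _.
have := normFD ((Qh - Q)^T *m Sbh) (Q^T *m (Sbh - S *m b)); lra.
Qed.

Lemma sketched_norms m n d (S : 'M[R]_(d, m)) (A : 'M[R]_(m, n)) (b : 'cV[R]_m)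
    eta (x : 'cV[R]_n) : eta <= 9 / 10 -> sketching S (row_mx A b) eta ->
  nF (S *m b) <= 19 / 10 * nF b /\
  nF (S *m (b - A *m x)) <= 2 * nF (b - A *m x).
Proof.
move=> eta9 SAb; split.
  by have := sketching_row 0 1 eta9 SAb; rewrite mulmx0 add0r scale1r.
have := sketching_row (- x) 1 eta9 SAb; rewrite mulmxN scale1r addrC => H.
by apply: le_trans H _; rewrite ler_wpM2r//; lra.
Qed.

(** The theorem for one instance, with a single number [L] in place of the four
    given prefactors. *)
Lemma meta_algorithm_bounds (L : R) (m n d : nat) (A : 'M[R]_(m, n)) (b :
  'cV[R]_m)
    (x : 'cV[R]_n) (u eta : R) (S : 'M[R]_(d, m)) (SAh : 'M[R]_(d, n)) (Sbh :
      'cV[R]_d)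
    (solver : inner_solver (R := R) n) (Rh : 'M[R]_n) (xh0 xh1 xh2 : 'cV[R]_n) :
  let kappa := cond A in
  let res := nF (b - A *m x) in
  let P := 1000 * (m%:R + 4) ^+ 5 * L in
  (n <= m)%N -> spectral_norm A = 1 -> nF b = 1 -> is_argmin A b x ->
  0 < u -> 1 <= L ->
  meta_algorithm u A b S eta SAh Sbh solver Rh xh0 xh1 xh2 ->
  0 < sigma_min A -> 10 ^+ 8 * (P ^+ 2 * L) * (kappa * u) <= 1 ->
  nF x + kappa * (nF x + kappa * res) * u <= L * nF xh2 ->
  sketching S A eta -> (d <= n ^ 3)%N -> eta <= 9 / 10 ->
  spectral_norm (SAh - S *m A) <= L * u -> nF (Sbh - S *m b) <= L * u ->
  (forall c dy : 'cV[R]_n, solver (fl_operator u A Rh) c dy ->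
    nF (dy - invmx (preconditioned A Rh) *m c) <= L * (kappa * u * nF c)) ->
  nF (A *m (x - xh1)) <= 6 * 10 ^+ 4 * (P * u) * (nF x + kappa * res) /\
  backward_error A b xh2 <= 10 ^+ 9 * (P ^+ 2 * L) * u.
Proof.
move=> kappa res P nm A1 b1 xmin u_gt0 L1 [SAb [Qh [z [QRE zE x0E x1E x2E]]]].
move=> s0 small Bx SA dn eta9 SAhE SbhE sE; have u0 := ltW u_gt0.
have [Age k1] := cond_bounds A1 s0; rewrite -/kappa in Age k1.
have Ale (v : 'cV_n) : nF (A *m v) <= nF v.
  by have := spectral_norm_bound A v; rewrite A1 mul1r.
have k0 : 0 <= kappa by apply: le_trans k1.
have [mN dN] := dims_le_cube nm dn.
have nq : n%:R <= m%:R + 4 :> R by rewrite (le_trans (_ :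
  n%:R <= m%:R :> R)) ?ler_nat// lerDl.
have q4 : 4 <= m%:R + 4 :> R by rewrite lerDr.
have NE : ((m + 4) ^ 3)%:R = (m%:R + 4) ^+ 3 :> R by rewrite natrX natrD.
have PE : P = 1000 * (m%:R + 4) ^+ 5 * L by [].
move: q4 nq NE PE small; set N := ((m + 4) ^ 3)%N in mN dN *.
move: (m%:R + 4) P => q P q4 nq NE PE small.
have [e eE] : exists e, e = 2 * q ^+ 3 * u by eexists.
have [U UE] : exists U, U = P * u by eexists.
have [P1000 omK om [ue uU] [e3 en enU [zU SQU kE LuU Lu1]]] :=
  rounding_budget q4 (ler0n R n) nq L1 u0 k1 eE PE UE small.
have P0 : 0 <= P by apply: le_trans P1000.
have e0 : 0 <= e by apply: le_trans ue.
have Lu0 : 0 <= L * u by rewrite mulr_ge0// (le_trans _ L1).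
have e2 : e <= 1 / 2 by apply: le_trans e3 _; clear; lra.
have U0 : 0 <= U by rewrite UE mulr_ge0.
have gN k : (k <= N)%N -> gam u k <= e.
  move=> kN; apply: le_trans (ler_gam u0 kN) _; rewrite eE -NE;
    apply: gam_le => //.
  by rewrite NE -eE; move: e2; clear; lra.
have gd : gam u d.+1 <= e by apply: gN; exact: ltnW.
have gn : gam u n.+2 <= e by apply: gN; apply: leq_trans mN; rewrite !ltnS.
have gm : gam u m.+1 <= e by apply: gN; exact: ltnW.
have SAhE' (v : 'cV_n) : nF ((SAh - S *m A) *m v) <= L * u * nF v.
  by apply: le_trans (spectral_norm_bound _ _) _; rewrite ler_wpM2r.
have [Q [QQ QhQ SQT [Tle Tge] [Tu T0]]] :=
  sketched_qr u0 ue gd en e3 Ale Age Lu0 kE Lu1 SA eta9 SAhE' QRE.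
have An : nF A <= n%:R.
  by rewrite -[leRHS]mul1r; apply: normF_le_op => // v; rewrite mul1r.
have Tn : nF Rh <= 2 * n%:R.
  by apply: normF_le_op => // v; apply: le_trans (Tle v) _; rewrite ler_wpM2l.
have sE' c dy : solver (fl_operator u A Rh) c dy ->
    nF (dy - invmx (preconditioned A Rh) *m c) <= kappa * U * nF c.
  move=> H; apply: le_trans (sE c dy H) _; rewrite mulrA ler_wpM2r//.
  by rewrite mulrCA ler_wpM2l.
have refE xh x' : fl_refine u A b solver Rh xh x' ->
  refine_errors kappa U A Rh b xh x'.
  exact: fl_refine_errors u0 ue gn gm e2 Tu T0 An Tn enU uU sE'.
have [Sb_le Sr_le] := sketched_norms x eta9 SAb; rewrite b1 mulr1 in Sb_le.
have en' : 140 * (e * n%:R) <= 1.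
  by apply: le_trans en; rewrite ler_wpM2r ?ler_nat// mulr_ge0.
have zE' := le_trans (sketched_rhs u0 gd Lu0 Lu1 en' QQ QhQ Sb_le SbhE zE) zU.
have x0E' : nF (Rh *m xh0 - z) <= U * nF xh0.
  apply: le_trans (fl_solve_err u0 Tu T0 ue gn e2 x0E) _;
    rewrite mulrA ler_wpM2r//.
  apply: le_trans enU; have -> : 12 * (e * n%:R) = 6 * e * (2 * n%:R) by ring.
  by rewrite ler_wpM2l// mulr_ge0.
have Ar := argmin_normal_equations xmin.
have SQT' (v : 'cV_n) : nF (S *m (A *m v) - Q *m (Rh *m v)) <= U * nF v.
  by apply: le_trans (SQT v) _; rewrite ler_wpM2r.
have al0 := sketch_and_solve_error Ale Age Tge k1 U0 om QQ SQT' Sr_le b1 zE'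
  x0E'.
have [al1 be] := refined_iterates Ale Age Tge k1 U0 om Ar b1 al0
  (refE _ _ x1E) (refE _ _ x2E) UE u_gt0 P1000 L1 omK Bx.
split; first by rewrite -UE.
have -> : 10 ^+ 9 * (P ^+ 2 * L) * u = 10 ^+ 9 * (U * (P * L)) by rewrite UE;
  ring.
exact: be.
Qed.

End Assembly.

(** * Polynomial prefactors *)

Section Prefactors.
Context {R : realType}.
Implicit Types (c : {poly {poly R}}) (m n k : nat).

Lemma prefactorD c1 c2 m n :
  prefactor (c1 + c2) m n = prefactor c1 m n + prefactor c2 m n.
Proof. by rewrite /prefactor !hornerD. Qed.

Lemma prefactorM c1 c2 m n :
  prefactor (c1 * c2) m n = prefactor c1 m n * prefactor c2 m n.
Proof. by rewrite /prefactor !hornerM. Qed.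

Lemma prefactorXn c k m n : prefactor (c ^+ k) m n = prefactor c m n ^+ k.
Proof. by rewrite /prefactor !horner_exp. Qed.

Lemma prefactor_nat k m n : prefactor (k%:R : {poly {poly R}}) m n = k%:R.
Proof. by rewrite /prefactor -!polyC_natr !hornerC. Qed.

Lemma prefactorX m n : prefactor ('X : {poly {poly R}}) m n = m%:R.
Proof. by rewrite /prefactor hornerX hornerC. Qed.

Definition prefactorE := (prefactorD, prefactorM, prefactorXn, prefactor_nat,
  prefactorX).

End Prefactors.

Theorem theorem6p1 (R : realType) (cB cSA cSb cD : {poly {poly R}}) :
  exists cA cF cBE : {poly {poly R}},
  forall (m n d : nat) (A : 'M[R]_(m, n)) (b : 'cV[R]_m) (x : 'cV[R]_n)
    (u eta : R) (S : 'M[R]_(d, m)) (SAh : 'M[R]_(d, n)) (Sbh : 'cV[R]_d)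
    (solver : inner_solver (R := R) n) (Rh : 'M[R]_n)
    (xh0 xh1 xh2 : 'cV[R]_n),
  let kappa := cond A in
  let res := euclidean_norm (b - A *m x) in
  (n <= m)%N ->
  spectral_norm A = 1 ->
  euclidean_norm b = 1 ->
  is_argmin A b x ->
  0 < u ->
  meta_algorithm u A b S eta SAh Sbh solver Rh xh0 xh1 xh2 ->
  (* (A) *)
  0 < sigma_min A /\ much_less cA m n (kappa * u) 1 ->
  (* (B) *)
  lesssim cB m n
    (euclidean_norm x + kappa * (euclidean_norm x + kappa * res) * u)
    (euclidean_norm xh2) ->
  (* (C) *)
  [/\ sketching S A eta,
      (d <= n ^ 3)%N,
      eta <= 9 / 10,
      lesssim cSA m n (spectral_norm (SAh - S *m A)) (spectral_norm A * u)
    & lesssim cSb m n (euclidean_norm (Sbh - S *m b)) (euclidean_norm b * u)] ->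
  (* (D) *)
  (forall c dy : 'cV[R]_n, solver (fl_operator u A Rh) c dy ->
    lesssim cD m n
      (euclidean_norm
         (dy - invmx ((invmx Rh)^T *m A^T *m A *m invmx Rh) *m c))
      (kappa * u * euclidean_norm c)) ->
  strongly_forward_stable cF u A b x xh1 /\ backward_stable cBE u A b xh2.
Proof.
(* A sum of squares plus one is at least 1 and, as [t <= 1 + t^2], dominates
   each of the given prefactors. *)
pose cL := 1%:R + cB ^+ 2 + cSA ^+ 2 + cSb ^+ 2 + cD ^+ 2.
have cLE m n : prefactor cL m n = 1 + prefactor cB m n ^+ 2
    + prefactor cSA m n ^+ 2 + prefactor cSb m n ^+ 2 + prefactor cD m n ^+ 2.
  by rewrite !prefactorE.
clearbody cL; pose cP := 1000%:R * ('X + 4%:R) ^+ 5 * cL.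
have cPE m n : prefactor cP m n = 1000 * (m%:R + 4) ^+ 5 * prefactor cL m n.
  by rewrite !prefactorE.
clearbody cP.
exists (10%:R ^+ 8 * (cP ^+ 2 * cL)), (6%:R * 10%:R ^+ 4 * cP),
  (10%:R ^+ 9 * (cP ^+ 2 * cL)).
move=> m n d A b x u eta S SAh Sbh solver Rh xh0 xh1 xh2 kappa res nm A1 b1
  xmin.
move=> u0 alg [s0 kE] BE [SA dn eta9 SAE SbE] sE.
rewrite euclideanE in b1; rewrite /much_less in kE;
  rewrite /lesssim /res !euclideanE in BE.
rewrite /lesssim A1 mul1r in SAE; rewrite /lesssim !euclideanE b1 mul1r in SbE.
set pB := prefactor cB m n in BE; set pSA := prefactor cSA m n in SAE.
set pSb := prefactor cSb m n in SbE.
pose L := prefactor cL m n.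
have LE : L = 1 + pB ^+ 2 + pSA ^+ 2 + pSb ^+ 2 + prefactor cD m n ^+ 2.
  exact: cLE.
have sq (t : R) : t <= 1 + t ^+ 2 by have := sqr_ge0 (t - 1 / 2); lra.
have sB := sqr_ge0 pB; have sSA := sqr_ge0 pSA; have sSb := sqr_ge0 pSb.
have sD := sqr_ge0 (prefactor cD m n).
have L1 : 1 <= L by lra.
have LB : pB <= L by have := sq pB; lra.
have LSA : pSA <= L by have := sq pSA; lra.
have LSb : pSb <= L by have := sq pSb; lra.
have LD : prefactor cD m n <= L by have := sq (prefactor cD m n); lra.
have [Age k1] := cond_bounds A1 s0; rewrite -/kappa in Age k1.
have k0 : 0 <= kappa by apply: le_trans k1.
have [] := @meta_algorithm_bounds R L m n d A b x u eta S SAh Sbh solver Rh xh0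
  xh1 xh2.
- by [].
- exact: A1.
- exact: b1.
- exact: xmin.
- exact: u0.
- exact: L1.
- exact: alg.
- exact: s0.
- by move: kE; rewrite !prefactorE cPE.
- by apply: le_trans BE _; rewrite ler_wpM2r.
- exact: SA.
- exact: dn.
- exact: eta9.
- by apply: le_trans SAE _; rewrite ler_wpM2r// ltW.
- by apply: le_trans SbE _; rewrite ler_wpM2r// ltW.
- move=> c dy /sE; rewrite /lesssim !euclideanE => H; apply: le_trans H _.
  by rewrite ler_wpM2r//; apply: mulr_ge0 => //; apply: mulr_ge0 (ltW u0).
rewrite -/kappa => al1 be.
set P := 1000 * _ * L in al1 be.
have P0 : 0 <= P by rewrite mulr_ge0 ?(le_trans ler01 L1)// mulr_ge0//
  exprn_ge0// addr_ge0.
have u_ge0 := ltW u0; have L0 : 0 <= L by apply: le_trans L1.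
split.
  have eps0 : 0 <= 6 * 10 ^+ 4 * (P * u).
    by apply: mulr_ge0; [move: L1; clear; lra|exact: mulr_ge0].
  have rho0 : 0 <= nF x + kappa * nF (b - A *m x) by rewrite addr_ge0//
    mulr_ge0.
  exists (6 * 10 ^+ 4 * (P * u)); split.
  - by rewrite /lesssim !prefactorE cPE -/L -/P mulrA.
  - rewrite !euclideanE A1 divr1 -/kappa; apply: le_trans (Age _) _.
    have := ler_wpM2l k0 al1; have := mulr_ge0 (mulr_ge0 k0 rho0) eps0; lra.
  - rewrite !euclideanE A1 mul1r -/kappa; apply: le_trans al1 _.
    have := mulr_ge0 rho0 eps0; lra.
rewrite /backward_stable /lesssim !prefactorE cPE -/L -/P; apply: le_trans be _.
rewrite [leRHS]mulrCA ler_peMl//; last by rewrite -A1 spectral_norm_le_normF.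
apply: mulr_ge0 => //; apply: mulr_ge0; first by move: L1; clear; lra.
by apply: mulr_ge0 => //; exact: exprn_ge0.
Qed.
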